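(* For every $\varepsilon\in(0,\frac1{2\sqrt2})$ and every $M>0$ there exist $E\in C_c^\infty(\mathbb{R}^2)$ and $\Lambda<\infty$ such that $\operatorname{Hess}E\ge-\Lambda I$ on $\mathbb{R}^2$ (in the sense of symmetric matrices), and such that the curve $u(t)=\bigl(\varepsilon\sqrt t,\ \sqrt t\,(1-t)\bigr)$, $t\in[0,1]$, is the unique continuous function $[0,1]\to\mathbb{R}^2$ satisfying the mild (Volterra) equation $$u(t)=-\frac1{\Gamma(\frac12)}\int_0^t(t-s)^{-1/2}\nabla E(u(s))\,\mathrm ds,\qquad 0\le t\le1.$$ Since $u\in AC([0,1];\mathbb{R}^2)$, it is also the unique absolutely continuous classical solution satisfying $$\partial_t^{1/2}u(t)=-\nabla E(u(t)),\qquad u(0)=0,\qquad 0<t\le1.$$ Moreover, for this $E$ the following hold on $[0,1]$. For every $t\in(0,1]$, $$\frac{\mathrm d}{\mathrm dt}E(u(t))=-\bigl\langle\partial_t^{1/2}u(t),u'(t)\bigr\rangle=\frac{\Gamma(\frac32)}{2\sqrt t}\Bigl[\tfrac92\,t(1-t)-(1+\varepsilon^2)\Bigr].$$ Hence, for $t\in(0,1]$, $\frac{\mathrm d}{\mathrm dt}E(u(t))>0$ precisely when $$t\in(t_-,t_+),\qquad t_\pm=\frac12\Bigl(1\pm\sqrt{1-\tfrac{8(1+\varepsilon^2)}9}\Bigr),$$ and this interval is nonempty if and only if $\varepsilon<\frac1{2\sqrt2}$. The function $t\mapsto\frac{\mathrm d}{\mathrm dt}E(u(t))$ attains its global maximum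 on $(0,1]$ at $$t_*=\frac{9+\sqrt{81+216(1+\varepsilon^2)}}{54}.$$ For $\varepsilon=0.1$ one has (numerical values rounded to the displayed digits) $(t_-,t_+)\approx(0.34013895,\,0.65986105)$, $t_*\approx0.48696745$ and $\max_{0<t\le1}\frac{\mathrm d}{\mathrm dt}E(u(t))\approx0.07253820$. As $\varepsilon\downarrow0$, $t_-\to\frac13$ and $t_+\to\frac23$.
   Context: Caputo derivative of order $1/2$: for an absolutely continuous curve $v\in AC([0,1];\mathbb{R}^2)$, $\partial_t^{1/2}v(t):=\frac{1}{\Gamma(1/2)}\int_0^t (t-s)^{-1/2}v'(s)\,\mathrm ds$ (for general absolutely continuous $v$ this is defined for almost every $t$; for the explicit curve $u$ it is defined for every $t\in(0,1]$). $C_c^\infty(\mathbb{R}^2)$ denotes smooth compactly supported real-valued functions, and $I$ is the $2\times2$ identity matrix. The parameter $M>0$ is the transverse stiffness used in the paper's construction of $E$; it does not otherwise enter the statement. *)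

(* Defs.v *)
From HB Require Import structures.
From mathcomp Require Import all_boot all_order all_algebra.
From mathcomp Require Import all_classical all_reals all_analysis.

Set Implicit Arguments.
Unset Strict Implicit.
Unset Printing Implicit Defensive.

Import Order.TTheory GRing.Theory Num.Theory.
Import numFieldNormedType.Exports.

Local Open Scope classical_set_scope.
Local Open Scope ring_scope.

(* Euler's integral; only used for x > 0, where it converges. *)
Definition Gamma (R : realType) (x : R) : R :=
  (\int[lebesgue_measure]_(s in `[0%R, +oo[) (s `^ (x - 1) * expR (- s)))%R.

(* Points of R^n are row vectors, a function on [0, 1] is a total function on R
   of which only the values on [0, 1] matter. *)

Definition dot (R : realType) (n : nat) (x y : 'rV[R]_n) : R :=
  (x *m y^T) 0 0.

Definition partial (R : realType) (n : nat) (i : 'I_n) (f : 'rV[R]_n -> R) :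
  'rV[R]_n -> R := 'D_(delta_mx 0 i) f.

Definition iter_partial (R : realType) (n : nat) (s : seq 'I_n)
  (f : 'rV[R]_n -> R) : 'rV[R]_n -> R := foldr (@partial R n) f s.

Definition smooth (R : realType) (n : nat) (f : 'rV[R]_n -> R) : Prop :=
  forall s : seq 'I_n, continuous (iter_partial s f) /\
    forall (i : 'I_n) (x : 'rV[R]_n),
      derivable (iter_partial s f) x (delta_mx 0 i).

Definition compactly_supported (R : realType) (n : nat) (f : 'rV[R]_n -> R) :
  Prop := compact (closure [set x | f x != 0]).

Definition grad (R : realType) (n : nat) (f : 'rV[R]_n -> R)
  (x : 'rV[R]_n) : 'rV[R]_n := \row_i partial i f x.

Definition Hess (R : realType) (n : nat) (f : 'rV[R]_n -> R)
  (x : 'rV[R]_n) : 'M[R]_n := \matrix_(i, j) partial i (partial j f) x.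

(* The Loewner order. It is only used on symmetric matrices: the Hessian of a
   smooth function is symmetric. *)
Definition loewner_le (R : realType) (n : nat) (A B : 'M[R]_n) : Prop :=
  forall w : 'rV[R]_n, 0 <= (w *m (B - A) *m w^T) 0 0.

Definition abs_continuous (R : realType) (V : normedModType R) (a b : R)
  (v : R -> V) : Prop :=
  forall e : R, 0 < e -> exists2 d : R, 0 < d &
    forall (n : nat) (l r : 'I_n -> R),
      (forall i, [/\ a <= l i, l i <= r i & r i <= b]) ->
      trivIset setT (fun i => `]l i, r i[%classic) ->
      \sum_i (r i - l i) < d ->
      \sum_i `|v (r i) - v (l i)| < e.

Definition half_kernel (R : realType) (n : nat) (f : R -> 'rV[R]_n) (t : R)
  (i : 'I_n) (s : R) : R := (t - s) `^ (- 2^-1) * f s 0 i.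

(* The Riemann-Liouville integral of order 1/2 of f, taken coordinatewise.
   The integrand takes the value 0 at s = t, by the convention on powR. *)
Definition half_integral (R : realType) (n : nat) (f : R -> 'rV[R]_n) (t : R) :
  'rV[R]_n :=
  (Gamma (2^-1 : R))^-1 *:
    \row_i (\int[lebesgue_measure]_(s in `[0%R, t]) half_kernel f t i s)%R.

(* The integral defining half_integral f t converges absolutely. *)
Definition half_integrable (R : realType) (n : nat) (f : R -> 'rV[R]_n)
  (t : R) : Prop :=
  forall i : 'I_n,
    lebesgue_measure.-integrable `[0%R, t] (EFin \o half_kernel f t i).

Definition caputo_half (R : realType) (n : nat) (v : R -> 'rV[R]_n) :
  R -> 'rV[R]_n := half_integral (derive1 v).

Definition caputo_half_defined (R : realType) (n : nat) (v : R -> 'rV[R]_n) :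
  R -> Prop := half_integrable (derive1 v).

Definition mild_solution (R : realType) (n : nat) (E : 'rV[R]_n -> R)
  (v : R -> 'rV[R]_n) : Prop :=
  {within `[0%R, 1%R], continuous v} /\
  forall t : R, 0 <= t <= 1 -> v t = - half_integral (grad E \o v) t.

Definition classical_solution (R : realType) (n : nat) (E : 'rV[R]_n -> R)
  (v : R -> 'rV[R]_n) : Prop :=
  [/\ abs_continuous 0 1 v,
      v 0 = 0 &
      forall t : R, 0 < t <= 1 ->
        caputo_half_defined v t /\ caputo_half v t = - grad E (v t)].

(* P holds at u, and only at u among curves on [0, 1]. *)
Definition unique_on01 (R : realType) (n : nat) (P : (R -> 'rV[R]_n) -> Prop)
  (u : R -> 'rV[R]_n) : Prop :=
  P u /\ forall v, P v -> forall t : R, 0 <= t <= 1 -> v t = u t.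

Definition curve (R : realType) (eps t : R) : 'rV[R]_2 :=
  \row_i (if i == 0 then eps * Num.sqrt t else Num.sqrt t * (1 - t)).

(* Num.sqrt is 0 at negative arguments, so when there are no real roots the
   interval ]tminus eps, tplus eps[ is empty. *)
Definition tminus (R : realType) (eps : R) : R :=
  2^-1 * (1 - Num.sqrt (1 - 8 * (1 + eps ^+ 2) / 9)).

Definition tplus (R : realType) (eps : R) : R :=
  2^-1 * (1 + Num.sqrt (1 - 8 * (1 + eps ^+ 2) / 9)).

Definition tstar (R : realType) (eps : R) : R :=
  (9 + Num.sqrt (81 + 216 * (1 + eps ^+ 2))) / 54.

(* x rounds to the eight-digit decimal 0.abc, where a, b and c are its
   successive blocks of 3, 3 and 2 digits. *)
Definition rounds_to8 (R : realType) (x : R) (a b c : nat) : Prop :=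
  `|x - (a%:R / 10 ^+ 3 + b%:R / 10 ^+ 6 + c%:R / 10 ^+ 8)|
    <= 2^-1 / 10 ^+ 8.

(* Main.v *)
From HB Require Import structures.
From mathcomp Require Import all_boot all_order all_algebra.
From mathcomp Require Import all_classical all_reals all_analysis.
From mathcomp Require Import measurable_realfun ring lra.
Require Import Defs.

Set Implicit Arguments.
Unset Strict Implicit.
Unset Printing Implicit Defensive.

Import Order.TTheory GRing.Theory Num.Theory.
Import numFieldNormedType.Exports.

Local Open Scope classical_set_scope.
Local Open Scope ring_scope.

(** Write c = Gamma(3/2) and u = curve eps. The Caputo derivative of u is
    explicit: the coordinates of u' are combinations of 1/sqrt s and sqrt s, whose
    integrals against 1/sqrt (t - s) are Beta integrals, and one finds
    c (eps, 1 - 3 t / 2) (lemma caputo_half_curve). The curve is a graph over its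
    first coordinate x = eps sqrt t, so an energy whose gradient along u is the
    opposite of that vector can be written down: a polynomial in x plus a
    polynomial in x times y, multiplied by a smooth plateau function which is 1
    around the curve (energy, partial_energy_curve). Everything about the rate of
    change of the energy then concerns the elementary function rate.

    The Hessian of a smooth compactly supported function is bounded, which gives
    Lambda, and its gradient is Lipschitz. The kernel has mass 2 sqrt h on an
    interval of length h, so two mild solutions which agree up to some time agree
    for a fixed further amount of time (mild_solution_unique).

    That absolutely continuous classical solutions are mild solutions is the one
    step which needs more than explicit integrals. It applies the half-integral to the
    equation: by Fubini two half-integrals in a row make an ordinary integral,
    since the two kernels combine to the Beta integral B(1/2, 1/2) = pi
    (abel_abel), and the ordinary integral of v' is the increment of v. The last
    fact, for absolutely continuous v, is proved in abs_continuous_ftc: the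
    variation of v is absolutely continuous, so v is a difference of two
    nondecreasing absolutely continuous functions; the Lebesgue-Stieltjes measure
    of each of these has no singular part, hence a density by the Radon-Nikodym
    theorem.

    For the decimal values, pi is located by the signs of Taylor polynomials of
    the cosine next to pi/2, and square roots by comparing squares. *)

(** * The two coordinates *)

Lemma ord2P (i : 'I_2) : i = 0 \/ i = 1.
Proof. by case: i => -[|[|//]] i2; [left|right]; exact: val_inj. Qed.

Lemma sum_ord2 (V : nmodType) (f : 'I_2 -> V) : \sum_i f i = f 0 + f 1.
Proof.
by rewrite !big_ord_recl big_ord0 addr0; congr (f _ + f _); exact: val_inj.
Qed.

Lemma rV2_eq (R : Type) (x y : 'rV[R]_2) : x 0 0 = y 0 0 -> x 0 1 = y 0 1 -> x = y.
Proof. by move=> e0 e1; apply/rowP => i; have [->|->] := ord2P i. Qed.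

(** * Pointwise derivatives *)

(** Derivability and the value of the derivative in one proposition, so that
    every rule of differentiation is a single implication. *)
Definition has_deriv {R : realType} (f : R -> R) (x a : R) : Prop :=
  derivable f x 1 /\ 'D_1 f x = a.

Section has_deriv.
Context {R : realType}.
Implicit Types (f g : R -> R) (x a b c : R).

Lemma has_derivP f x a : has_deriv f x a <-> is_derive x 1 f a.
Proof. by split => -[]. Qed.

Lemma has_deriv_eq f x a b : has_deriv f x a -> a = b -> has_deriv f x b.
Proof. by move=> ? <-. Qed.

Lemma has_deriv_derive1 f x a : has_deriv f x a -> derive1 f x = a.
Proof. by move=> [_ <-]; rewrite derive1E. Qed.

Lemma has_derivD f g x a b : has_deriv f x a -> has_deriv g x b ->
  has_deriv (fun y => f y + g y) x (a + b).
Proof.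
by move=> /has_derivP df /has_derivP dg; apply/has_derivP; exact: (@is_deriveD _ _ _ f g).
Qed.

Lemma has_derivN f x a : has_deriv f x a -> has_deriv (fun y => - f y) x (- a).
Proof.
by move=> /has_derivP df; apply/has_derivP; exact: (@is_deriveN _ _ _ f).
Qed.

Lemma has_derivB f g x a b : has_deriv f x a -> has_deriv g x b ->
  has_deriv (fun y => f y - g y) x (a - b).
Proof. by move=> df dg; apply: has_derivD => //; exact: has_derivN. Qed.

Lemma has_derivM f g x a b : has_deriv f x a -> has_deriv g x b ->
  has_deriv (fun y => f y * g y) x (a * g x + f x * b).
Proof.
move=> /has_derivP df /has_derivP dg; apply/has_derivP.
have := @is_deriveM _ _ f g x 1 a b df dg.
by rewrite addrC /GRing.scale /= [g x * a]mulrC.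
Qed.

Lemma has_derivZ f x a c : has_deriv f x a ->
  has_deriv (fun y => c * f y) x (c * a).
Proof.
by move=> /has_derivP df; apply/has_derivP; exact: (@is_deriveZ _ _ _ f c).
Qed.

Lemma has_deriv_cst c x : has_deriv (fun=> c) x 0.
Proof. by apply/has_derivP; exact: is_derive_cst. Qed.

Lemma has_deriv_id x : has_deriv (fun y => y) x 1.
Proof. by apply/has_derivP; exact: is_derive_id. Qed.

Lemma has_derivV f x a : f x != 0 -> has_deriv f x a ->
  has_deriv (fun y => (f y)^-1) x (- (a / f x ^+ 2)).
Proof.
move=> fx /has_derivP df; apply/has_derivP.
have := @is_deriveV _ f x a 1 fx df.
by rewrite /GRing.scale /= mulNr mulrC.
Qed.

Lemma has_deriv_comp f g x a b : has_deriv f (g x) a -> has_deriv g x b ->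
  has_deriv (fun y => f (g y)) x (a * b).
Proof.
by move=> /has_derivP df /has_derivP dg; apply/has_derivP; try exact: (@is_derive1_comp _ f g).
Qed.

Lemma has_deriv_sqrt f x a : 0 < f x -> has_deriv f x a ->
  has_deriv (fun y => Num.sqrt (f y)) x (a / (2 * Num.sqrt (f x))).
Proof.
move=> fx df; rewrite mulrC; apply: (has_deriv_comp _ df).
by apply/has_derivP; exact: is_derive1_sqrt.
Qed.

Lemma has_deriv_atan f x a : has_deriv f x a ->
  has_deriv (fun y => atan (f y)) x (a / (1 + f x ^+ 2)).
Proof.
move=> df; rewrite mulrC; apply: (has_deriv_comp _ df).
by apply/has_derivP; exact: is_derive1_atan.
Qed.

Lemma has_deriv_expR f x a : has_deriv f x a ->
  has_deriv (fun y => expR (f y)) x (a * expR (f x)).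
Proof.
move=> df; rewrite mulrC; apply: (has_deriv_comp _ df).
by apply/has_derivP; exact: is_derive_expR.
Qed.

Lemma has_deriv_csub c x : has_deriv (fun y => c - y) x (-1).
Proof.
rewrite -(sub0r 1); apply: has_derivB; [exact: has_deriv_cst|exact: has_deriv_id].
Qed.

Lemma has_deriv_subc c x : has_deriv (fun y => y - c) x 1.
Proof.
apply: has_deriv_eq (subr0 1).
apply: has_derivB; [exact: has_deriv_id|exact: has_deriv_cst].
Qed.

Lemma has_deriv_continuous f x a : has_deriv f x a -> {for x, continuous f}.
Proof.
move=> [df _]; apply: differentiable_continuous; exact/derivable1_diffP.
Qed.

Lemma eq_has_deriv f g x a : f =1 g -> has_deriv f x a -> has_deriv g x a.
Proof. by move=> /funext ->. Qed.

Lemma near_eq_has_deriv f g x a : {near x, f =1 g} -> has_deriv f x a -> has_deriv g x a.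
Proof.
move=> fg /has_derivP df; apply/has_derivP.
exact: (@near_eq_is_derive _ _ _ f g).
Qed.

Lemma has_derivX n x : has_deriv (fun y : R => y ^+ n) x (n%:R * x ^+ n.-1).
Proof.
elim: n => [|n IH].
  by rewrite mul0r; exact: has_deriv_cst.
apply: (@eq_has_deriv (fun y => y * y ^+ n)) => [y|]; first by rewrite exprS.
apply: has_deriv_eq; first exact: has_derivM (has_deriv_id x) IH.
case: n {IH} => [|n] /=; first by ring.
by rewrite -[n.+2]addn1 natrD exprS; ring.
Qed.

Lemma contD f g x : {for x, continuous f} -> {for x, continuous g} ->
  {for x, continuous (fun y => f y + g y)}.
Proof. exact: continuousD. Qed.

Lemma contB f g x : {for x, continuous f} -> {for x, continuous g} ->
  {for x, continuous (fun y => f y - g y)}.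
Proof. exact: continuousB. Qed.

Lemma contM f g x : {for x, continuous f} -> {for x, continuous g} ->
  {for x, continuous (fun y => f y * g y)}.
Proof. exact: continuousM. Qed.

Lemma contZ c f x : {for x, continuous f} ->
  {for x, continuous (fun y => c * f y)}.
Proof. by move=> cf; apply: contM => //; exact: cst_continuous. Qed.

Lemma contV f x : f x != 0 -> {for x, continuous f} ->
  {for x, continuous (fun y => (f y)^-1)}.
Proof. exact: continuousV. Qed.

Lemma cont_comp f g x : {for g x, continuous f} -> {for x, continuous g} ->
  {for x, continuous (fun y => f (g y))}.
Proof. by move=> cf cg; exact: (@continuous_comp _ _ _ g f). Qed.

Lemma cont_sqrt f x : {for x, continuous f} ->
  {for x, continuous (fun y => Num.sqrt (f y))}.
Proof. by move=> cf; apply: cont_comp => //; exact: sqrt_continuous. Qed.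

Lemma cont_csub c x : {for x, continuous (fun y => c - y)}.
Proof. exact: has_deriv_continuous (has_deriv_csub c x). Qed.

Lemma cont_subc c x : {for x, continuous (fun y => y - c)}.
Proof. exact: has_deriv_continuous (has_deriv_subc c x). Qed.

End has_deriv.

(** * Integrals of unbounded functions by primitives *)
Section improper.
Context {R : realType}.
Notation mu := (@lebesgue_measure R).

(** Monotone convergence along an exhaustion by compact intervals. *)
Lemma improper_FTC2_exhaust (f F : R -> R) (D : set R) (a b : R^nat) (la lb : R) :
  measurable D -> measurable_fun D f -> (forall x, D x -> 0 <= f x) ->
  (forall x, D x -> has_deriv F x (f x)) ->
  (forall x, D x -> {for x, continuous f}) ->
  (forall n, a n < b n) ->
  {homo (fun n => [set` `[a n, b n]]) : n m / (n <= m)%N >-> (n <= m)%O} ->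
  \bigcup_n [set` `[a n, b n]] = D ->
  F (a n) @[n --> \oo] --> la -> F (b n) @[n --> \oo] --> lb ->
  (\int[mu]_(x in D) (f x)%:E = (lb - la)%:E)%E.
Proof.
move=> mD mf f0 dF cf ab nd UD Fa Fb.
have sub n x : `[a n, b n]%classic x -> D x by rewrite -UD => ?; exists n.
have Fcont n x : `[a n, b n]%classic x -> {for x, continuous F}.
  move=> /sub Dx; exact: has_deriv_continuous (dF _ Dx).
have E n : (\int[mu]_(x in `[a n, b n]) (f x)%:E = (F (b n) - F (a n))%:E)%E.
  rewrite (@continuous_FTC2 _ f F) //; last 3 first.
  - apply: continuous_in_subspaceT => x /[!inE] /sub; exact: cf.
  - have cF : {within `[a n, b n], continuous F}.
      by apply: continuous_in_subspaceT => x /[!inE]; exact: Fcont.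
    have [_ ? ?] := (continuous_within_itvP _ (ab n)).1 cF.
    split => // x xab; have Dx : D x by apply: (sub n); apply: subset_itv_oo_cc.
    by have [] := dF x Dx.
  - move=> x xab; rewrite derive1E.
    have Dx : D x by apply: (sub n); apply: subset_itv_oo_cc.
    by have [_ ->] := dF x Dx.
have H : ((\int[mu]_(x in `[a n, b n]) (f x)%:E)%E @[n --> \oo] -->
    (\int[mu]_(x in D) (f x)%:E)%E).
  rewrite -UD; apply: ge0_nondecreasing_set_cvg_integral => //.
  - by move=> n; apply/measurable_EFinP; apply: measurable_funS mf => //; exact: sub.
  - by move=> n x /sub /f0; rewrite lee_fin.
apply/esym/(cvg_unique _ _ H) => //.
rewrite /= (_ : (fun n => _) = (fun n => (F (b n) - F (a n))%:E)); last exact/funext.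
by apply: cvg_EFin; [exact: nearW|apply: cvgB].
Qed.

(** Fundamental theorem of calculus for a nonnegative integrand that may blow up
    at both endpoints. *)
Lemma improper_FTC2 (f F : R -> R) (a b : R) : a < b ->
  (forall x, a < x < b -> 0 <= f x) ->
  (forall x, a < x < b -> has_deriv F x (f x)) ->
  (forall x, a < x < b -> {for x, continuous f}) ->
  (forall x, a <= x <= b -> {for x, continuous F}) ->
  (\int[mu]_(x in `[a, b]) (f x)%:E = (F b - F a)%:E)%E.
Proof.
move=> ab f0 dF cf cF'.
have cF : {within `[a, b], continuous F}.
  by apply: continuous_in_subspaceT => x /[!inE] /=; rewrite in_itv; exact: cF'.
have mf : measurable_fun `]a, b[ f.
  apply: open_continuous_measurable_fun => // x.
  by rewrite inE /= in_itv; exact: cf.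
have ba : 0 < b - a by rewrite subr_gt0.
have invS (n : nat) : 0 < (n.+2)%:R^-1 :> R by rewrite invr_gt0.
have hlim : (n.+2)%:R^-1 * (b - a) @[n --> \oo] --> (0 : R).
  rewrite -[X in _ --> X](mul0r (b - a)); apply: cvgMl.
  have := @cvg_harmonic R; rewrite -cvg_shiftS => H.
  by apply: cvg_trans H.
have cl : {in `]a, b[, continuous F} /\ F @ a^'+ --> F a /\ F @ b^'- --> F b.
  by have [? ? ?] := (continuous_within_itvP _ ab).1 cF.
have Fa : F (a + (n.+2)%:R^-1 * (b - a)) @[n --> \oo] --> F a.
  have [_ [/cvg_at_rightP + _]] := cl; apply; split => [n|].
    by rewrite ltrDl mulr_gt0//; exact: invS.
  rewrite -[X in _ --> X](addr0 a); apply: cvgD => //; exact: cvg_cst.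
have Fb : F (b - (n.+2)%:R^-1 * (b - a)) @[n --> \oo] --> F b.
  have [_ [_ /cvg_at_leftP]] := cl; apply; split => [n|].
    by rewrite gtrDl oppr_lt0 mulr_gt0//; exact: invS.
  rewrite -[X in _ --> X](subr0 b); apply: cvgB => //; exact: cvg_cst.
rewrite (@integral_itv_bndoo _ a b _ true false); last exact/measurable_EFinP.
apply: (@improper_FTC2_exhaust f F _
  (fun n => a + (n.+3)%:R^-1 * (b - a)) (fun n => b - (n.+3)%:R^-1 * (b - a))) => //.
- move=> n; have : (n.+3)%:R^-1 <= 3^-1 :> R by rewrite lef_pV2 ?posrE// ler_nat.
  move=> h; have : (n.+3)%:R^-1 * (b - a) <= 3^-1 * (b - a) by rewrite ler_pM2r.
  by set d := _ * (b - a); move: ba; lra.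
- move=> n m nm; rewrite subsetEset; apply: subset_itv; rewrite bnd_simp.
    by rewrite lerD2l ler_pM2r// lef_pV2 ?posrE ?ltr0n// ler_nat.
  by rewrite lerD2l lerN2 ler_pM2r// lef_pV2 ?posrE ?ltr0n// ler_nat.
- apply/seteqP; split => x /=.
    move=> [n _ /=]; rewrite !in_itv /= => /andP[h1 h2].
    have h : 0 < (n.+3)%:R^-1 * (b - a) by rewrite mulr_gt0.
    by move: h h1 h2; set d := _ * (b - a) => ? ? ?; apply/andP; split; lra.
  rewrite in_itv /= => /andP[ax xb].
  pose d := Num.min (x - a) (b - x).
  have d0 : 0 < d by rewrite lt_min !subr_gt0 ax.
  have : \forall n \near \oo, (n.+2)%:R^-1 * (b - a) < d.
    have /cvgrPdist_lt/(_ _ d0) := hlim.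
    apply: filterS => n; rewrite sub0r normrN ger0_norm//.
    by rewrite mulr_ge0// ltW.
  move=> [N _ /(_ N.+1 (leqnSn N))] /= h; exists N => //=.
  move: h; rewrite /d lt_min in_itv /=; set e := _ * (b - a) => /andP[? ?].
  by apply/andP; split; lra.
- by move: Fa; rewrite -cvg_shiftS.
- by move: Fb; rewrite -cvg_shiftS.
Qed.

(** The same over the half-line. *)
Lemma improper_FTC2y (f F : R -> R) (l : R) :
  (forall x : R, 0 < x -> 0 <= f x) ->
  (forall x : R, 0 < x -> has_deriv F x (f x)) ->
  (forall x : R, 0 < x -> {for x, continuous f}) ->
  F x @[x --> (0:R)^'+] --> F 0 -> F x @[x --> +oo%R] --> l ->
  (\int[mu]_(x in `[0%R, +oo[) (f x)%:E = (l - F 0)%:E)%E.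
Proof.
move=> f0 dF cf F0 Fl.
have mf : measurable_fun `](0:R), +oo[ f.
  apply: open_continuous_measurable_fun => // x.
  by rewrite inE /= in_itv/= andbT; exact: cf.
have nS n : 0 < (n.+2)%:R :> R by [].
rewrite -integral_itv_obnd_cbnd; last exact/measurable_EFinP.
apply: (@improper_FTC2_exhaust f F _ (fun n => (n.+2)%:R^-1) (fun n => (n.+2)%:R)) => //.
- by move=> x; rewrite /= in_itv/= andbT; exact: f0.
- by move=> x; rewrite /= in_itv/= andbT; exact: dF.
- by move=> x; rewrite /= in_itv/= andbT; exact: cf.
- move=> n; rewrite (@lt_le_trans _ _ 1)// ?ler1n//.
  by rewrite invf_lt1// ltr1n.
- move=> n m nm; rewrite subsetEset; apply: subset_itv; rewrite bnd_simp.
    by rewrite lef_pV2 ?posrE ?ltr0n// ler_nat.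
  by rewrite ler_nat.
- apply/seteqP; split => x /=.
    move=> [n _ /=]; rewrite !in_itv /= andbT => /andP[h1 h2].
    by apply: lt_le_trans h1; rewrite invr_gt0.
  rewrite in_itv /= andbT => x0.
  pose N := Num.truncn (x + x^-1).
  have hN : x + x^-1 < (N.+1)%:R.
    by apply: truncnS_gt.
  have xi : 0 < x^-1 by rewrite invr_gt0.
  exists N => //=; rewrite in_itv/= -[N.+2]addn1 natrD.
  apply/andP; split; last by move: hN xi; lra.
  rewrite -[leRHS]invrK lef_pV2 ?posrE// ?ltr_wpDr//.
  by move: hN x0; lra.
- move/cvg_at_rightP : F0; apply; split => [n|]; first by rewrite invr_gt0.
  by have := @cvg_harmonic R; rewrite -cvg_shiftS.
- move/cvg_pinftyP : Fl; apply.
  by have := @cvgr_idn R; rewrite -2!cvg_shiftS.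
Qed.

End improper.

Section improper_integrable.
Context {R : realType}.
Notation mu := (@lebesgue_measure R).

Lemma improper_FTC2_integrable (f F : R -> R) (a b : R) : a < b ->
  (forall x, a < x < b -> 0 <= f x) ->
  (forall x, a < x < b -> has_deriv F x (f x)) ->
  (forall x, a < x < b -> {for x, continuous f}) ->
  (forall x, a <= x <= b -> {for x, continuous F}) ->
  mu.-integrable `[a, b] (EFin \o f) /\ \int[mu]_(x in `[a, b]) f x = F b - F a.
Proof.
move=> ab f0 dF cf cF.
have E := improper_FTC2 ab f0 dF cf cF.
split; last by rewrite /Rintegral E.
have mf : measurable_fun `]a, b[ f.
  apply: open_continuous_measurable_fun => // x.
  by rewrite inE /= in_itv; exact: cf.
have mf' : measurable_fun `[a, b] f.
  apply/measurable_fun_itv_bndo_bndcP/measurable_fun_itv_obnd_cbndP; exact: mf.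
apply/integrableP; split; first exact/measurable_EFinP.
rewrite (@integral_itv_bndoo _ a b _ true false); last first.
  exact/measurable_EFinP/measurableT_comp.
rewrite (@integral_itv_bndoo _ a b _ true false) in E; last exact/measurable_EFinP.
under eq_integral.
  move=> x; rewrite inE /= in_itv /= => /f0 ?; rewrite ger0_norm//; over.
by rewrite E ltry.
Qed.
End improper_integrable.

(** * Integrals against the kernel of order one half *)
Section abel_kernel_integrals.
Context {R : realType}.
Notation mu := (@lebesgue_measure R).

Lemma powR_Nhalf (a : R) : 0 <= a -> a `^ (- 2^-1) = (Num.sqrt a)^-1.
Proof. by move=> a0; rewrite powRN powR12_sqrt. Qed.

Lemma Rintegral_abel_cst (r t : R) : r < t ->
  mu.-integrable `[r, t] (EFin \o fun s => (Num.sqrt (t - s))^-1) /\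
  \int[mu]_(s in `[r, t]) (Num.sqrt (t - s))^-1 = 2 * Num.sqrt (t - r).
Proof.
move=> rt; pose f s := (Num.sqrt (t - s))^-1.
pose F s := (- 2) * Num.sqrt (t - s).
have -> : 2 * Num.sqrt (t - r) = F t - F r.
  by rewrite /F subrr sqrtr0; ring.
have gt0 x : r < x < t -> 0 < Num.sqrt (t - x).
  by move=> /andP[_ xt]; rewrite sqrtr_gt0 subr_gt0.
apply: (@improper_FTC2_integrable _ f F).
- by [].
- by move=> x rxt; rewrite invr_ge0 sqrtr_ge0.
- move=> x rxt; have x0 := gt0 _ rxt.
  apply: has_deriv_eq.
    apply: has_derivZ; apply: has_deriv_sqrt.
      by rewrite -sqrtr_gt0.
    exact: has_deriv_csub.
  by rewrite /f; field; rewrite gt_eqF.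
- move=> x rxt; have x0 := gt0 _ rxt.
  apply: contV; first by rewrite gt_eqF.
  exact/cont_sqrt/cont_csub.
- move=> x _.
  apply: contZ; exact/cont_sqrt/cont_csub.
Qed.

Lemma Rintegral_abel_id (t : R) : 0 < t ->
  mu.-integrable `[0, t] (EFin \o fun s => (Num.sqrt (t - s))^-1 * s) /\
  \int[mu]_(s in `[0, t]) ((Num.sqrt (t - s))^-1 * s) = 4 / 3 * t * Num.sqrt t.
Proof.
move=> t0; pose f s := (Num.sqrt (t - s))^-1 * s.
pose F s := (- 2 * t) * Num.sqrt (t - s) + 2 / 3 * ((t - s) * Num.sqrt (t - s)).
have -> : 4 / 3 * t * Num.sqrt t = F t - F 0.
  by rewrite /F subrr sqrtr0 subr0; field.
have gt0 x : 0 < x < t -> 0 < Num.sqrt (t - x).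
  by move=> /andP[_ xt]; rewrite sqrtr_gt0 subr_gt0.
apply: (@improper_FTC2_integrable _ f F).
- by [].
- by move=> x /andP[x0 _]; rewrite mulr_ge0 ?invr_ge0 ?sqrtr_ge0// ltW.
- move=> x rxt; have x0 := gt0 _ rxt.
  have tx0 : 0 < t - x by rewrite -sqrtr_gt0.
  apply: has_deriv_eq.
    apply: has_derivD; apply: has_derivZ.
      apply: has_deriv_sqrt; [by []|exact: has_deriv_csub].
    apply: has_derivM; first exact: has_deriv_csub.
    apply: has_deriv_sqrt; [by []|exact: has_deriv_csub].
  rewrite /f; have : Num.sqrt (t - x) ^+ 2 = t - x by rewrite sqr_sqrtr// ltW.
  set S := Num.sqrt _ in x0 * => S2; have -> : x = t - S ^+ 2 by rewrite S2; ring.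
  by field; rewrite gt_eqF.
- move=> x rxt; have x0 := gt0 _ rxt.
  apply: contM => //; apply: contV; first by rewrite gt_eqF.
  exact/cont_sqrt/cont_csub.
- move=> x _.
  apply: contD; (apply: contZ).
    exact/cont_sqrt/cont_csub.
  apply: contM; first exact: cont_csub.
  exact/cont_sqrt/cont_csub.
Qed.

(** By the half-angle formula this is 2 asin (sqrt ((s - r) / (t - r))), written
    so that it is differentiable without case distinction and visibly continuous
    at both endpoints. *)
Definition beta_primitive (r t s : R) : R :=
  4 * atan (Num.sqrt (s - r) / (Num.sqrt (t - r) + Num.sqrt (t - s))).

Lemma has_deriv_beta_primitive (r t s : R) : r < s < t ->
  has_deriv (beta_primitive r t) s
    ((Num.sqrt (t - s))^-1 * (Num.sqrt (s - r))^-1).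
Proof.
move=> /andP[rs st]; have rt := lt_trans rs st.
have A2 : Num.sqrt (s - r) ^+ 2 = s - r by rewrite sqr_sqrtr// subr_ge0 ltW.
have B2 : Num.sqrt (t - s) ^+ 2 = t - s by rewrite sqr_sqrtr// subr_ge0 ltW.
have C2 : Num.sqrt (t - r) ^+ 2 = t - r by rewrite sqr_sqrtr// subr_ge0 ltW.
have A0 : 0 < Num.sqrt (s - r) by rewrite sqrtr_gt0 subr_gt0.
have B0 : 0 < Num.sqrt (t - s) by rewrite sqrtr_gt0 subr_gt0.
have C0 : 0 < Num.sqrt (t - r) by rewrite sqrtr_gt0 subr_gt0.
apply: has_deriv_eq.
  apply: has_derivZ; apply: has_deriv_atan.
  apply: has_derivM.
    apply: has_deriv_sqrt; [by rewrite subr_gt0|exact: has_deriv_subc].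
  apply: has_derivV; first by rewrite gt_eqF// addr_gt0.
  apply: has_derivD; first exact: has_deriv_cst.
  apply: has_deriv_sqrt; [by rewrite subr_gt0|exact: has_deriv_csub].
have C2' : Num.sqrt (t - r) ^+ 2 = Num.sqrt (s - r) ^+ 2 + Num.sqrt (t - s) ^+ 2.
  by rewrite A2 B2 C2; ring.
move: A0 B0 C0 C2' {A2 B2 C2}.
set A := Num.sqrt (s - r); set B := Num.sqrt (t - s); set C := Num.sqrt (t - r).
move=> A0 B0 C0 C2.
have CB : 0 < C + B by rewrite addr_gt0.
have D0 : (C + B) ^+ 2 + A ^+ 2 != 0 by rewrite gt_eqF// addr_gt0// exprn_gt0.
rewrite [LHS](_ : _ = 2 * (B * (C + B) + A ^+ 2) / (A * B * ((C + B) ^+ 2 + A ^+ 2))).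
  have A2 : A ^+ 2 = C ^+ 2 - B ^+ 2 by rewrite C2; ring.
  rewrite (_ : B * (C + B) + A ^+ 2 = C * (C + B)); last by rewrite A2; ring.
  rewrite (_ : (C + B) ^+ 2 + A ^+ 2 = 2 * (C * (C + B))); last by rewrite A2; ring.
  by field; rewrite !gt_eqF// addr_gt0.
field.
by rewrite D0 !gt_eqF.
Qed.

Lemma continuous_beta_primitive (r t s : R) : r < t ->
  {for s, continuous (beta_primitive r t)}.
Proof.
move=> rt.
apply: contZ.
apply: cont_comp; first exact: continuous_atan.
apply: contM; first exact/cont_sqrt/cont_subc.
apply: contV.
  by rewrite gt_eqF// ltr_wpDr ?sqrtr_ge0// sqrtr_gt0 subr_gt0.
apply: contD; first exact: cst_continuous.
exact/cont_sqrt/cont_csub.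
Qed.

Lemma beta_primitive_left (r t : R) : beta_primitive r t r = 0.
Proof. by rewrite /beta_primitive subrr sqrtr0 mul0r atan0 mulr0. Qed.

Lemma beta_primitive_right (r t : R) : r < t -> beta_primitive r t t = pi.
Proof.
move=> rt; rewrite /beta_primitive subrr sqrtr0 addr0 divff ?atan1; first by field.
by rewrite gt_eqF// sqrtr_gt0 subr_gt0.
Qed.

(** The Beta integral B(1/2, 1/2) = pi. *)
Lemma Rintegral_abel_beta (r t : R) : r < t ->
  mu.-integrable `[r, t]
    (EFin \o fun s => (Num.sqrt (t - s))^-1 * (Num.sqrt (s - r))^-1) /\
  \int[mu]_(s in `[r, t]) ((Num.sqrt (t - s))^-1 * (Num.sqrt (s - r))^-1) = pi.
Proof.
move=> rt; pose f s := (Num.sqrt (t - s))^-1 * (Num.sqrt (s - r))^-1.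
have -> : pi = beta_primitive r t t - beta_primitive r t r.
  by rewrite beta_primitive_left beta_primitive_right// subr0.
apply: (@improper_FTC2_integrable _ f (beta_primitive r t)).
- by [].
- by move=> x _; rewrite mulr_ge0 ?invr_ge0 ?sqrtr_ge0.
- by move=> x; exact: has_deriv_beta_primitive.
- move=> x /andP[rx xt].
  apply: contM; apply: contV;
    rewrite ?gt_eqF ?sqrtr_gt0 ?subr_gt0//.
    exact/cont_sqrt/cont_csub.
  exact/cont_sqrt/cont_subc.
- by move=> x _; exact: continuous_beta_primitive.
Qed.

(** The Beta integral B(3/2, 1/2) = pi / 2, scaled to [0, t]. *)
Lemma Rintegral_abel_sqrt (t : R) : 0 < t ->
  mu.-integrable `[0, t]
    (EFin \o fun s => (Num.sqrt (t - s))^-1 * Num.sqrt s) /\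
  \int[mu]_(s in `[0, t]) ((Num.sqrt (t - s))^-1 * Num.sqrt s) = t * pi / 2.
Proof.
move=> t0; pose f s := (Num.sqrt (t - s))^-1 * Num.sqrt s.
pose F s := t / 2 * beta_primitive 0 t s - Num.sqrt (s - 0) * Num.sqrt (t - s).
have -> : t * pi / 2 = F t - F 0.
  rewrite /F beta_primitive_left beta_primitive_right// subrr sqrtr0 mulr0.
  by rewrite subr0 subrr sqrtr0; field.
apply: (@improper_FTC2_integrable _ f F).
- by [].
- by move=> x _; rewrite mulr_ge0 ?invr_ge0 ?sqrtr_ge0.
- move=> x /andP[x0 xt]; apply: has_deriv_eq.
    apply: has_derivB.
      by apply: has_derivZ; apply: has_deriv_beta_primitive; rewrite x0.
    apply: has_derivM; apply: has_deriv_sqrt; try by rewrite subr_gt0.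
      exact: has_deriv_subc.
    exact: has_deriv_csub.
  rewrite /f subr0.
  have : Num.sqrt (t - x) ^+ 2 = t - x by rewrite sqr_sqrtr// subr_ge0 ltW.
  have : Num.sqrt x ^+ 2 = x by rewrite sqr_sqrtr// ltW.
  have : 0 < Num.sqrt x by rewrite sqrtr_gt0.
  have : 0 < Num.sqrt (t - x) by rewrite sqrtr_gt0 subr_gt0.
  set A := Num.sqrt x; set B := Num.sqrt (t - x) => B0 A0 A2 B2.
  have -> : t = A ^+ 2 + B ^+ 2 by rewrite A2 B2; ring.
  by field; rewrite !gt_eqF.
- move=> x /andP[rx xt].
  apply: contM; last exact: sqrt_continuous.
  apply: contV; first by rewrite ?gt_eqF ?sqrtr_gt0 ?subr_gt0.
  exact/cont_sqrt/cont_csub.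
- move=> x _.
  apply: contB.
    apply: contZ.
    exact: continuous_beta_primitive.
  apply: contM; apply/cont_sqrt.
    exact: cont_subc.
  exact: cont_csub.
Qed.

End abel_kernel_integrals.

(** * The values Gamma(1/2) and Gamma(3/2) *)
Section gamma_values.
Context {R : realType}.
Notation mu := (@lebesgue_measure R).

Let G := @gauss_integral_proof.integral0_gauss R.

Let has_deriv_G (x : R) : 0 < x -> has_deriv G x (gauss_fun x).
Proof.
move=> x0.
have := @continuous_FTC1_closed R gauss_fun 0 x (x + 1).
rewrite ltrDl => /(_ ltr01) H.
have [] := H _ x0 _.
- apply: continuous_compact_integrable; first exact: segment_compact.
  by apply: continuous_subspaceT => ?; exact: continuous_gauss_fun.
- exact: continuous_gauss_fun.
by rewrite derive1E.
Qed.

Let G_ge0 x : 0 <= G x := gauss_integral_proof.integral0_gauss_ge0 x.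

Let G_le x : 0 <= x -> G x <= x.
Proof.
move=> x0; rewrite -[leRHS](_ : \int[mu]_(t in `[0, x]) (cst 1 t) = _); last first.
  rewrite Rintegral_cst//= mul1r lebesgue_measure_itv/= lte_fin.
  by case: ltgtP x0 => //= _ _; rewrite subr0.
apply: le_Rintegral => //.
- apply: continuous_compact_integrable; first exact: segment_compact.
  by apply: continuous_subspaceT => ?; exact: continuous_gauss_fun.
- apply: continuous_compact_integrable; first exact: segment_compact.
  by apply: continuous_subspaceT => ?; exact: cst_continuous.
- by move=> y _; exact: gauss_fun_le1.
Qed.

Let cvgy_G : G x @[x --> +oo%R] --> Num.sqrt pi / 2.
Proof.
have : Num.sqrt (G x ^+ 2) @[x --> +oo%R] --> Num.sqrt (pi / 4).
  apply: (@cvg_comp _ _ _ (fun x => G x ^+ 2) (@Num.sqrt R)); last exact: sqrt_continuous.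
  exact: gauss_integral_proof.cvg_integral0_gauss_sqr.
rewrite sqrtrM ?pi_ge0// sqrtrV// (_ : 4 = 2 ^+ 2); last by ring.
rewrite sqrtr_sqr ger0_norm// (_ : (fun _ => Num.sqrt _) = G)//.
by apply/funext => x; rewrite sqrtr_sqr ger0_norm.
Qed.

Let cvgy_sqrt : Num.sqrt x @[x --> +oo%R] --> (+oo%R : set_system R).
Proof.
apply/cvgryPge => A; near=> x.
have [A0|A0] := leP 0 A; last by rewrite (le_trans (ltW A0))// sqrtr_ge0.
rewrite -(ler_pXn2r (ltn0Sn 1)) ?nnegrE ?sqrtr_ge0// sqr_sqrtr.
  by near: x; apply: nbhs_pinfty_ge; rewrite ?num_real.
by near: x; apply: nbhs_pinfty_ge; rewrite ?num_real.
Unshelve. all: by end_near. Qed.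

Let cvgy_G_sqrt : G (Num.sqrt x) @[x --> +oo%R] --> Num.sqrt pi / 2.
Proof. exact: cvg_comp cvgy_sqrt cvgy_G. Qed.

Let G0 : G 0 = 0.
Proof. by apply/eqP; rewrite eq_le G_ge0 andbT G_le. Qed.

Let cvg0_G_sqrt : G (Num.sqrt x) @[x --> (0:R)^'+] --> G (Num.sqrt 0).
Proof.
rewrite sqrtr0 G0; apply: (@squeeze_cvgr _ _ _ _ (fun=> 0) (@Num.sqrt R)).
- by near=> x; rewrite G_ge0 G_le// sqrtr_ge0.
- exact: cvg_cst.
- rewrite -[X in _ --> X]sqrtr0; apply: cvg_at_right_filter.
  exact: sqrt_continuous.
Unshelve. all: by end_near. Qed.

Let has_deriv_G_sqrt (x : R) : 0 < x ->
  has_deriv (fun y => G (Num.sqrt y)) x (expR (- x) / (2 * Num.sqrt x)).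
Proof.
move=> x0; have s0 : 0 < Num.sqrt x by rewrite sqrtr_gt0.
apply: has_deriv_eq.
  apply: has_deriv_comp; first exact: has_deriv_G.
  by apply: has_deriv_sqrt; [exact: x0|exact: has_deriv_id].
by rewrite /gauss_fun sqr_sqrtr ?ltW// mul1r.
Qed.

Let cont_expRN (x : R) : {for x, continuous (fun y => expR (- y))}.
Proof. by apply: cont_comp; [exact: continuous_expR|exact: opp_continuous]. Qed.

(** With G x the integral of exp (- t ^ 2) over [0, x], the function
    2 G (sqrt s) is a primitive of the integrand, and G tends to sqrt pi / 2. *)
Lemma Gamma_half : Gamma (2^-1 : R) = Num.sqrt pi.
Proof.
pose f (s : R) := s `^ (2^-1 - 1) * expR (- s).
pose F (s : R) := 2 * G (Num.sqrt s).
have fE x : 0 < x -> f x = (Num.sqrt x)^-1 * expR (- x).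
  by move=> x0; rewrite /f (_ : 2^-1 - 1 = - 2^-1) ?powR_Nhalf ?ltW//; field.
rewrite /Gamma /Rintegral (@improper_FTC2y _ f F (2 * (Num.sqrt pi / 2))) /=.
- by rewrite /F sqrtr0 G0; field.
- by move=> x x0; rewrite /f mulr_ge0 ?powR_ge0 ?expR_ge0.
- move=> x x0; have s0 : 0 < Num.sqrt x by rewrite sqrtr_gt0.
  apply: has_deriv_eq; first by apply: has_derivZ; exact: has_deriv_G_sqrt.
  by rewrite fE//; field; rewrite gt_eqF.
- move=> x x0; apply: contM; last exact: cont_expRN.
  by have := @is_derive1_powR R (2^-1 - 1) x x0 => /has_derivP/has_deriv_continuous.
- by apply: cvgM; [exact: cvg_cst|exact: cvg0_G_sqrt].
- by apply: cvgM; [exact: cvg_cst|exact: cvgy_G_sqrt].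
Qed.

(** Integration by parts in the previous integral: the primitive here is
    G (sqrt s) - sqrt s exp (- s). *)
Lemma Gamma_three_halves : Gamma (3 / 2 : R) = Num.sqrt pi / 2.
Proof.
pose f (s : R) := s `^ (3 / 2 - 1) * expR (- s).
pose F (s : R) := G (Num.sqrt s) - Num.sqrt s * expR (- s).
have fE x : 0 < x -> f x = Num.sqrt x * expR (- x).
  by move=> x0; rewrite /f (_ : 3 / 2 - 1 = 2^-1) ?powR12_sqrt ?ltW//; field.
rewrite /Gamma /Rintegral (@improper_FTC2y _ f F (Num.sqrt pi / 2 - 0)) /=.
- by rewrite /F sqrtr0 G0; ring.
- by move=> x x0; rewrite /f mulr_ge0 ?powR_ge0 ?expR_ge0.
- move=> x x0; have s0 : 0 < Num.sqrt x by rewrite sqrtr_gt0.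
  apply: has_deriv_eq.
    apply: has_derivB; first exact: has_deriv_G_sqrt.
    apply: has_derivM; first by apply: has_deriv_sqrt; [exact: x0|exact: has_deriv_id].
    by apply: has_deriv_expR; apply: has_derivN; exact: has_deriv_id.
  by rewrite fE//; field; rewrite gt_eqF.
- move=> x x0; apply: contM; last exact: cont_expRN.
  by have := @is_derive1_powR R (3 / 2 - 1) x x0 => /has_derivP/has_deriv_continuous.
- apply: cvgB; first exact: cvg0_G_sqrt.
  apply: cvg_at_right_filter.
  by apply: contM; [exact: sqrt_continuous|exact: cont_expRN].
- apply: cvgB; first exact: cvgy_G_sqrt.
  apply/cvgrPdist_lt => e e0; near=> x.
  have x1 : 1 <= x by near: x; apply: nbhs_pinfty_ge; rewrite ?num_real.
  have xe : 2 / e < x by near: x; apply: nbhs_pinfty_gt; rewrite ?num_real.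
  have x0 : 0 < x by exact: lt_le_trans x1.
  rewrite sub0r normrN ger0_norm ?mulr_ge0 ?sqrtr_ge0 ?expR_ge0//.
  rewrite expRN ltr_pdivrMr ?expR_gt0//.
  have h1 : Num.sqrt x <= x.
    rewrite -(ler_pXn2r (ltn0Sn 1)) ?nnegrE ?sqrtr_ge0 ?(ltW x0)// sqr_sqrtr ?(ltW x0)//.
    by rewrite expr2 ler_peMl// ltW.
  have h2 : x ^+ 2 / 2 <= expR x.
    have := @expR_ge1Dxn R x 1 (ltW x0); rewrite (_ : 2`!%:R = 2)//.
    by apply: le_trans; rewrite lerDr.
  apply: (le_lt_trans h1); apply: (@lt_le_trans _ _ (e * (x ^+ 2 / 2))); last first.
    by rewrite ler_pM2l.
  rewrite -[ltLHS]mul1r expr2 (_ : e * (x * x / 2) = e * x / 2 * x); last by ring.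
  by rewrite ltr_pM2r// ltr_pdivlMr// mul1r mulrC -ltr_pdivrMr.
Unshelve. all: by end_near. Qed.

End gamma_values.

(** * Absolutely continuous functions are integrals of their derivative *)
Section ac_variation.
Context {R : realType}.
Implicit Type v : R -> R.

Lemma abs_continuous_fin (V : normedModType R) (v : R -> V) (a b : R) :
  abs_continuous a b v -> forall e : R, 0 < e -> exists2 d : R, 0 < d &
    forall (I : finType) (l r : I -> R),
      (forall i, [/\ a <= l i, l i <= r i & r i <= b]) ->
      trivIset setT (fun i => `]l i, r i[%classic) ->
      \sum_i (r i - l i) < d -> \sum_i `|v (r i) - v (l i)| < e.
Proof.
move=> ac e /ac[d d0 H]; exists d => // I l r lr tr ld.
have E (F : I -> R) : \sum_(i < #|I|) F (enum_val i) = \sum_i F i.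
  by rewrite -(big_enum_val (A := I)).
rewrite -[ltLHS]E; apply: (H _ (l \o enum_val) (r \o enum_val)).
- by move=> i; exact: lr.
- move=> i j _ _ ij; apply: enum_val_inj; exact: tr.
- by rewrite (E (fun i => r i - l i)).
Qed.

(** The cells of partitions of disjoint intervals are themselves disjoint
    intervals of the same total length, so absolute continuity controls the
    variation and not only the increments. *)
Lemma abs_continuous_variation v (a b : R) :
  abs_continuous a b v -> forall e : R, 0 < e -> exists2 d : R, 0 < d &
    forall (I : finType) (l r : I -> R) (s : I -> seq R),
      (forall i, [/\ a <= l i, l i <= r i & r i <= b]) ->
      trivIset setT (fun i => `]l i, r i[%classic) ->
      (forall i, itv_partition (l i) (r i) (s i)) ->
      \sum_i (r i - l i) < d -> \sum_i variation (l i) (r i) v (s i) < e.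
Proof.
move=> ac e e0; have [d d0 H] := abs_continuous_fin ac e0.
exists d => // I l r s lr tr ps ld.
pose p i j := nth (r i) (l i :: s i) j.
pose J i : finType := 'I_(size (s i)).
pose K : finType := {i : I & J i}.
have sumE (F : forall i, J i -> R) :
    \sum_i \sum_(j < size (s i)) F i j = \sum_(q : K) F (tag q) (tagged q).
  exact: (@sig_big_dep _ _ _ I J xpredT (fun=> xpredT) F).
have pge i (j : nat) : (j < (size (s i)).+1)%N -> l i <= p i j.
  by move=> js; exact: itv_partition_nth_ge.
have ple i (j : nat) : (j < (size (s i)).+1)%N -> p i j <= r i.
  by move=> js; exact: itv_partition_nth_le.
have pS i j : (j < size (s i))%N -> p i j < p i j.+1.
  by have [/(pathP (r i)) + _] := ps i; exact.
have pmono i j k : (j <= k)%N -> (k <= size (s i))%N -> p i j <= p i k.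
  elim: k => [|k IH]; first by rewrite leqn0 => /eqP ->.
  rewrite leq_eqVlt => /predU1P[->//|]; rewrite ltnS => jk ks.
  by rewrite (le_trans (IH jk (ltnW ks)))// ltW// pS.
have -> : \sum_i variation (l i) (r i) v (s i) =
    \sum_(q : K)
      `|v (p (tag q) (tagged q).+1) - v (p (tag q) (tagged q))|.
  rewrite -(sumE (fun i j => `|v (p i j.+1) - v (p i j)|)).
  by apply: eq_bigr => i _; rewrite /variation big_mkord.
apply: (H K (fun q => p (tag q) (tagged q)) (fun q => p (tag q) (tagged q).+1)).
- move=> [i j] /=; have [al lri rb] := lr i; have js := ltn_ord j; split.
  + by rewrite (le_trans al)// pge// ltnS ltnW.
  + by rewrite ltW// pS.
  + by rewrite (le_trans _ rb)// ple.
- move=> [i j] [i' j'] _ _ [x /= []]; rewrite !in_itv /= => /andP[x1 x2] /andP[x3 x4].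
  have ii' : i = i'.
    have js := ltn_ord j; have js' := ltn_ord j'.
    apply: tr => //; exists x; split; rewrite /= in_itv /=.
      by rewrite (le_lt_trans (pge i j (ltnW js)) x1) (lt_le_trans x2 (ple i j.+1 js)).
    by rewrite (le_lt_trans (pge i' j' (ltnW js')) x3) (lt_le_trans x4 (ple i' j'.+1 js')).
  subst i'; congr existT; apply/val_inj/eqP; rewrite eqn_leq; apply/andP; split.
  + rewrite leqNgt; apply/negP => jj.
    have := pmono i _ _ jj (ltnW (ltn_ord j)) => h1.
    by have := lt_trans (lt_le_trans x4 h1) x1; rewrite ltxx.
  + rewrite leqNgt; apply/negP => jj.
    have := pmono i _ _ jj (ltnW (ltn_ord j')) => h1.
    by have := lt_trans (lt_le_trans x2 h1) x3; rewrite ltxx.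
- rewrite -(sumE (fun i j => p i j.+1 - p i j)).
  rewrite (eq_bigr (fun i => r i - l i))// => i _.
  rewrite -(big_mkord xpredT (fun j => p i j.+1 - p i j)) telescope_sumr//.
  by rewrite /p (itv_partition_nth_size _ (ps i)).
Qed.

Lemma total_variation_le_cell v (a b e d : R) :
  (forall (I : finType) (l r : I -> R) (s : I -> seq R),
      (forall i, [/\ a <= l i, l i <= r i & r i <= b]) ->
      trivIset setT (fun i => `]l i, r i[%classic) ->
      (forall i, itv_partition (l i) (r i) (s i)) ->
      \sum_i (r i - l i) < d -> \sum_i variation (l i) (r i) v (s i) < e) ->
  forall l r : R, a <= l -> l <= r -> r <= b -> r - l < d ->
  (total_variation l r v <= e%:E)%E.
Proof.
move=> H l r al lr rb lrd; apply: ge_ereal_sup => _ [_ [s ps <-] <-].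
rewrite lee_fin ltW//.
have := H unit (fun=> l) (fun=> r) (fun=> s); rewrite !big_const card_unit /= !addr0.
by apply => // -[] [].
Qed.

(** Cut [a, b] into pieces so short that each has variation at most 1. *)
Lemma abs_continuous_bounded_variation v (a b : R) : a <= b ->
  abs_continuous a b v -> bounded_variation a b v.
Proof.
move=> ab ac; apply/bounded_variationP => //.
have [d d0 H] := abs_continuous_variation ac ltr01.
pose x (k : nat) : R := Num.min b (a + k%:R * (d / 2)).
have d20 : 0 < d / 2 by rewrite divr_gt0.
have xa k : a <= x k by rewrite le_min ab /= lerDl mulr_ge0// ltW.
have xb k : x k <= b by rewrite ge_min lexx.
have xS k : x k <= x k.+1.
  rewrite le_min ge_min lexx /= ge_min; apply/orP; right.
  by rewrite lerD2l ler_pM2r// ler_nat.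
have TVk k : (total_variation a (x k) v <= k%:R%:E)%E.
  elim: k => [|k IH].
    by rewrite /x mul0r addr0 (min_idPr ab) total_variationxx.
  rewrite (total_variationD v (xa k) (xS k)) -natr1 EFinD leeD//.
  apply: (total_variation_le_cell H) => //.
  rewrite ltrBlDr {1}/x gt_min; have [h|h] := leP b (a + k%:R * (d / 2)).
    by rewrite /x (min_idPl h) ltrDr d0.
  rewrite /x (min_idPr (ltW h)); apply/orP; right.
  by rewrite -addn1 natrD; move: d0; lra.
have [k bk] : exists k, x k = b.
  exists (Num.truncn ((b - a) / (d / 2))).+1; apply/min_idPl.
  by rewrite -lerBlDl -ler_pdivrMr// ltW// truncnS_gt.
rewrite ge0_fin_numE; last exact: total_variation_ge0.
by have := TVk k; rewrite bk => /le_lt_trans; apply; rewrite ltry.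
Qed.

Lemma abs_continuous_unif (V : normedModType R) (v : R -> V) (a b : R) :
  abs_continuous a b v -> forall e : R, 0 < e -> exists2 d : R, 0 < d &
    forall x y, a <= x <= b -> a <= y <= b -> `|x - y| < d -> `|v x - v y| < e.
Proof.
move=> ac e e0; have [d d0 H] := abs_continuous_fin ac e0.
exists d => // x y; wlog xy : x y / y <= x => [W xab yab xyd|].
  have [yx|/ltW xy] := leP y x; first exact: W.
  by rewrite distrC W// distrC.
move=> /andP[ax xb] /andP[ay yb]; rewrite ger0_norm ?subr_ge0// => xyd.
have := H unit (fun=> y) (fun=> x).
by rewrite !big_const card_unit /= !addr0; apply => // -[] [].
Qed.

Lemma abs_continuous_within (V : normedModType R) (v : R -> V) (a b : R) :
  abs_continuous a b v -> {within `[a, b], continuous v}.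
Proof.
move=> ac; apply/subspace_continuousP => x /=; rewrite in_itv /= => xab.
apply/cvgrPdist_lt => e e0; have [d d0 H] := abs_continuous_unif ac e0.
rewrite near_withinE; near=> y; rewrite /= in_itv /= => yab.
by apply: H => //; near: y; exact: cvgr_dist_lt.
Unshelve. all: by end_near. Qed.

End ac_variation.

Section ac_total_variation.
Context {R : realType}.
Implicit Type v : R -> R.

Lemma abs_continuousB v w (a b : R) :
  abs_continuous a b v -> abs_continuous a b w ->
  abs_continuous a b (fun x => v x - w x).
Proof.
move=> acv acw e e0; have e2 : 0 < e / 2 by rewrite divr_gt0.
have [d1 d10 H1] := acv _ e2; have [d2 d20 H2] := acw _ e2.
exists (Num.min d1 d2) => [|n l r lr tr]; first by rewrite lt_min d10.
rewrite lt_min => /andP[ld1 ld2].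
rewrite (splitr e); apply: le_lt_trans (ltrD (H1 n l r lr tr ld1) (H2 n l r lr tr ld2)).
rewrite -big_split /=; apply: ler_sum => i _.
by rewrite opprD addrACA -opprD ler_normB.
Qed.

(** Partitions which nearly realize the variation on each of the given
    intervals reduce this to the control of variations by lengths. *)
Lemma abs_continuous_total_variation v (a b : R) : a <= b ->
  abs_continuous a b v -> abs_continuous a b (fun x => fine (total_variation a x v)).
Proof.
move=> ab ac; have BV := abs_continuous_bounded_variation ab ac.
have TVfin x y : a <= x -> x <= y -> y <= b -> total_variation x y v \is a fin_num.
  move=> ax xy yb; apply/(bounded_variationP _ xy).
  exact: (bounded_variationl xy yb (bounded_variationr ax (le_trans xy yb) BV)).
move=> e e0; have [d d0 H] := abs_continuous_variation ac (divr_gt0 e0 (ltr0Sn R 1)).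
exists d => // n l r lr tr ld.
pose V i := fine (total_variation (l i) (r i) v).
rewrite (eq_bigr V); last first.
  move=> i _; have [al lri rb] := lr i.
  rewrite (total_variationD v al lri) fineD ?TVfin// ?(le_trans lri)//.
  by rewrite addrAC subrr add0r ger0_norm// fine_ge0// total_variation_ge0.
suff : \sum_i V i <= e / 2 by move/le_lt_trans; apply; rewrite ltr_pdivrMr// mulr_natr mulr2n ltrDl.
rewrite leNgt; apply/negP => eV.
(* Each of the n partitions may miss the variation of its interval by eta;
   the denominator n + 1 covers n = 0. *)
pose eta := (\sum_i V i - e / 2) / n.+1%:R.
have eta0 : 0 < eta by rewrite divr_gt0// subr_gt0.
have /choice[s hs] i : exists s, itv_partition (l i) (r i) s /\
    V i - eta < variation (l i) (r i) v s.
  have [al lri rb] := lr i.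
  have := ub_ereal_sup_adherent eta0 (TVfin _ _ al lri rb).
  move=> [_ [_ [s ps <-] <-]]; exists s; split => //.
  by rewrite -lte_fin EFinB /V fineK// TVfin.
have := H _ l r s lr tr (fun i => (hs i).1) ld.
apply/negP; rewrite -leNgt.
apply: le_trans (ler_sum _ (fun i _ => ltW (hs i).2)).
rewrite big_split /= sumrN sumr_const card_ord lerBrDr -lerBrDl.
rewrite -[leLHS]mulr_natr -[leRHS](_ : eta * n.+1%:R = _).
  by rewrite ler_pM2l// ler_nat.
by rewrite /eta divfK.
Qed.

End ac_total_variation.

Section cells.
Context {R : realType}.
Notation mu := (@lebesgue_measure R).

Definition cell (n k : nat) : set R := `](k%:R / n.+1%:R), (k.+1%:R / n.+1%:R)]%classic.

Lemma mem_cell n k (x : R) :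
  cell n k x <-> (k%:R < x * n.+1%:R /\ x * n.+1%:R <= k.+1%:R).
Proof.
rewrite /cell /= in_itv /= ltr_pdivrMr// ler_pdivlMr//.
by split => [/andP|[? ?]]//; apply/andP.
Qed.

Lemma trivIset_cell n : trivIset setT (fun k : 'I_n.+1 => cell n k).
Proof.
move=> i j _ _ [x [/mem_cell[i1 i2] /mem_cell[j1 j2]]].
have ij : (i < j.+1)%N by rewrite -(ltr_nat R) (lt_le_trans i1 j2).
have ji : (j < i.+1)%N by rewrite -(ltr_nat R) (lt_le_trans j1 i2).
by apply/val_inj/eqP; rewrite /= eqn_leq; apply/andP; split.
Qed.

Lemma measurable_cell n k : measurable (cell n k).
Proof. exact: measurable_itv. Qed.

Lemma lebesgue_measure_cell n k : mu (cell n k) = (n.+1%:R^-1)%:E.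
Proof.
rewrite lebesgue_measure_itv/= lte_fin ltr_pM2r ?invr_gt0// ltr_nat ltnSn.
by rewrite -EFinB -mulrBl -natrB ?leqnSn// subSnn mul1r.
Qed.

Lemma cell_cover n (x : R) : 0 < x <= 1 -> exists k : 'I_n.+1, cell n k x.
Proof.
move=> /andP[x0 x1].
have ex : exists j : nat, x * n.+1%:R <= j%:R.
  by exists n.+1; rewrite ler_piMl.
case: (ex_minnP ex) => -[|j] xj jmin.
  by move: xj; rewrite leNgt mulr_gt0.
have jn : (j < n.+1)%N by apply: jmin; rewrite ler_piMl.
exists (Ordinal jn); apply/mem_cell; split => //=.
by rewrite ltNge; apply/negP => /jmin; rewrite ltnn.
Qed.

(** Every point of an open set lies, from some mesh on, in a cell contained in
    that set; a measure that is small on all short unions of cells is thus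
    small on open sets of small length, and outer regularity concludes. *)
Lemma null_dominates_cells (nu : {measure set (measurableTypeR R) -> \bar R}) :
  (forall e : R, 0 < e -> exists2 d : R, 0 < d & forall n (S : {pred 'I_n.+1}),
    \sum_(k < n.+1 | S k) n.+1%:R^-1 < d ->
    (\sum_(k < n.+1 | S k) nu (cell n k) <= e%:E)%E) ->
  forall A, measurable A -> mu A = 0%E -> nu (A `&` `]0, 1]) = 0%E.
Proof.
move=> H A mA A0; apply/eqP; rewrite eq_le measure_ge0 andbT.
apply/lee_addgt0Pr => e e0; rewrite add0e.
have [d d0 {}H] := H _ e0.
have Afin : (mu A < +oo)%E by rewrite A0 ltry.
have [U [oU AU UA]] := lebesgue_regularity_outer mA Afin d0.
have mU : measurable U by exact: open_measurable.
have muU : (mu U < d%:E)%E.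
  rewrite -(setUIDK U A); apply: le_lt_trans (measureU2 _ _ _) _ => //.
  - exact: measurableI.
  - exact: measurableD.
  suff -> : (mu (U `&` A) + mu (U `\` A) = mu (U `\` A))%E by [].
  suff -> : mu (U `&` A) = 0%E by rewrite add0e.
  apply/eqP; rewrite eq_le measure_ge0 andbT -A0.
  by apply: le_measure; rewrite ?inE//; exact: measurableI.
pose S n := [pred k : 'I_n.+1 | `[< cell n k `<=` U >]].
pose W n := \big[setU/set0]_(k < n.+1 | S n k) cell n k.
have mW n : measurable (W n).
  by apply: bigsetU_measurable => k _; exact: measurable_cell.
have nuW n : (nu (W n) <= e%:E)%E.
  rewrite /W measure_bigsetU_ord//; last 2 first.
  - by move=> i; exact: measurable_cell.
  - exact: trivIset_cell.
  apply: H; rewrite -lte_fin -sumEFin; apply: le_lt_trans muU.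
  rewrite (eq_bigr (fun k : 'I_n.+1 => mu (cell n k))); last first.
    by move=> k _; rewrite lebesgue_measure_cell.
  rewrite -measure_bigsetU_ord; last 2 first.
  - by move=> i; exact: measurable_cell.
  - exact: trivIset_cell.
  apply: le_measure; rewrite ?inE//.
    by apply: bigsetU_measurable => k _; exact: measurable_cell.
  by move=> x; rewrite -bigcup_pred => -[k /asboolP kU] /kU.
pose V m := \bigcap_(n in [set n | (m <= n)%N]) W n.
have mV m : measurable (V m) by apply: bigcap_measurableType => n _.
have ndV : nondecreasing_seq V.
  move=> m p mp; rewrite subsetEset => x Vx n /= pn; apply: Vx.
  exact: leq_trans pn.
have sub : A `&` `]0, 1] `<=` \bigcup_m V m.
  move=> x [/AU Ux]; rewrite /= in_itv /= => x01.
  have [r /= r0 rU] : nbhs x U by exact: open_nbhs_nbhs.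
  exists (Num.truncn r^-1) => // n /= rn.
  have nr : n.+1%:R^-1 < r.
    rewrite -[ltRHS]invrK ltf_pV2 ?posrE ?invr_gt0//.
    by apply: lt_le_trans (truncnS_gt _) _; rewrite ler_nat.
  have [k kx] := cell_cover n x01.
  rewrite /W -bigcup_pred; exists k => //=; apply/asboolP => y ky; apply: rU.
  move/mem_cell : kx => [k1 k2]; move/mem_cell : ky => [k3 k4].
  rewrite /ball /= (lt_trans _ nr)//.
  rewrite -[ltRHS]mul1r ltr_pdivlMr// -[X in _ * X]ger0_norm// -normrM mulrBl ltr_norml.
  by rewrite -natr1 in k2 k4; apply/andP; split; lra.
apply: (@le_trans _ _ (nu (\bigcup_m V m))).
  apply: le_measure; rewrite ?inE//; first exact: measurableI.
  by apply: bigcup_measurable => m _; exact: mV.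
have := @nondecreasing_cvg_mu _ _ _ nu V mV (bigcup_measurable (fun k _ => mV k)) ndV.
move=> /cvg_lim <-//; apply: lime_le.
  apply: ereal_nondecreasing_is_cvgn => m p mp.
  apply: le_measure; [by rewrite inE; exact: mV..|].
  by rewrite -subsetEset; exact: ndV.
apply: nearW => m /=; apply: le_trans (nuW m).
apply: le_measure; [by rewrite inE; exact: mV|by rewrite inE; exact: mW|].
by move=> x /(_ m) /=; apply; rewrite leqnn.
Qed.
End cells.

Section ac_density.
Context {R : realType}.
Notation mu := (@lebesgue_measure R).

(** Composing with it makes a function on [0, 1] constant outside, as the
    Lebesgue-Stieltjes construction wants functions on the line. *)
Definition clamp01 (x : R) : R := Num.max 0 (Num.min x 1).

Lemma clamp01_bnd x : 0 <= clamp01 x <= 1.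
Proof. by rewrite /clamp01 le_max lexx /= ge_max ler01 /= ge_min lexx orbT. Qed.

Lemma clamp01_id x : 0 <= x <= 1 -> clamp01 x = x.
Proof. by move=> /andP[x0 x1]; rewrite /clamp01 (min_idPl x1) (max_idPr x0). Qed.

Lemma clamp01_nd : {homo clamp01 : x y / x <= y}.
Proof.
move=> x y xy; rewrite /clamp01 ge_max !le_max lexx /= le_min !ge_min xy lexx.
by rewrite orbT !orbT.
Qed.

Lemma clamp01_lip x y : `|clamp01 x - clamp01 y| <= `|x - y|.
Proof.
wlog xy : x y / y <= x.
  by move=> W; have [/W//|/ltW/W] := leP y x; rewrite distrC [leRHS]distrC.
rewrite !ger0_norm ?subr_ge0 ?clamp01_nd// /clamp01.
by case: (leP x 1); case: (leP y 1); case: (leP 0 x); case: (leP 0 y);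
  rewrite ?(max_idPr (@ler01 R)); lra.
Qed.

Lemma lebesgue_stieltjes_measure_oc (F : cumulative R R) (a b : R) : a <= b ->
  lebesgue_stieltjes_measure F `]a, b]%classic = (F b - F a)%:E.
Proof.
move=> ab; rewrite /lebesgue_stieltjes_measure /measure_extension/=.
by rewrite measurable_mu_extE/= ?wlength_itv_bnd//; exact: is_ocitv.
Qed.

(** The Lebesgue-Stieltjes measure of a nondecreasing absolutely continuous
    function has no singular part, and Radon-Nikodym gives its density. *)
Lemma nondecreasing_abs_continuous_density (F : R -> R) :
  abs_continuous 0 1 F -> {in `[0, 1] &, {homo F : x y / x <= y}} ->
  exists2 f : R -> R, mu.-integrable setT (EFin \o f) &
    forall t, 0 <= t <= 1 -> F t - F 0 = \int[mu]_(x in `[0, t]) f x.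
Proof.
move=> acF ndF.
pose Fc x := F (clamp01 x).
have nd : nondecreasing Fc.
  by move=> x y xy; apply: ndF; rewrite ?in_itv ?clamp01_bnd// clamp01_nd.
have rc : right_continuous Fc.
  apply: right_continuousW => x; apply/cvgrPdist_lt => e e0.
  have [d d0 H] := abs_continuous_unif acF e0.
  near=> y; apply: H; rewrite ?clamp01_bnd//.
  by apply: le_lt_trans (clamp01_lip _ _) _; near: y; exact: cvgr_dist_lt.
pose C : cumulative R R := HB.pack Fc (isCumulative.Build _ _ _ Fc nd rc).
have oc a b : a <= b -> lebesgue_stieltjes_measure C `]a, b]%classic = (Fc b - Fc a)%:E.
  exact: lebesgue_stieltjes_measure_oc.
have m01 : measurable (`]0, 1]%classic : set (measurableTypeR R)) by exact: measurable_itv.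
have fin : (lebesgue_stieltjes_measure C `]0%R, 1%R]%classic < +oo)%E.
  by rewrite oc// ltry.
pose nu := mfrestr m01 fin.
have numu : nu `<< mu.
  apply/null_content_dominatesP => A mA A0.
  apply: (@null_dominates_cells _ (lebesgue_stieltjes_measure C)) => // e e0.
  have [d d0 H] := abs_continuous_fin acF e0.
  exists d => // n S Sd.
  pose l (k : 'I_n.+1) : R := k%:R / n.+1%:R.
  pose r (k : 'I_n.+1) : R := if S k then k.+1%:R / n.+1%:R else l k.
  have lr' (k : 'I_n.+1) : l k <= k.+1%:R / n.+1%:R.
    by rewrite /l ler_pM2r ?invr_gt0// ler_nat.
  have l0 k : 0 <= l k by rewrite /l mulr_ge0.
  have r1 (k : 'I_n.+1) : k.+1%:R / n.+1%:R <= 1 :> R.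
    by rewrite ler_pdivrMr// mul1r ler_nat.
  have lr k : [/\ 0 <= l k, l k <= r k & r k <= 1].
    split => //; rewrite /r; case: ifP => // _.
    exact: le_trans (lr' k) (r1 k).
  have := H _ l r lr _ _.
  rewrite (bigID S) /= [X in _ + X]big1 ?addr0; last first.
    by move=> k /negbTE Sk; rewrite /r Sk subrr.
  rewrite [X in _ -> _ -> X < _](bigID S) /= [X in _ -> _ -> _ + X < _]big1 ?addr0; last first.
    by move=> k /negbTE Sk; rewrite /r Sk subrr normr0.
  move=> {}H.
  apply: (@le_trans _ _ (\sum_(k < n.+1 | S k) `|F (r k) - F (l k)|)%:E).
    rewrite -sumEFin; apply: lee_sum => k Sk.
    rewrite [leLHS](oc _ _ (lr' k)) lee_fin /Fc /r Sk !clamp01_id ?ler_norm//.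
      by rewrite l0 (le_trans (lr' k)).
    by rewrite r1 (le_trans (l0 k)).
  rewrite lee_fin ltW//; apply: H.
  - move=> i j _ _ [x []]; rewrite /r /= !in_itv /=.
    case: ifP => [_|_ /andP[/lt_trans /[apply]]]; last by rewrite ltxx.
    case: ifP => [_ /andP[i1 i2] /andP[j1 j2]|_ _ /andP[/lt_trans /[apply]]]; last by rewrite ltxx.
    apply: (@trivIset_cell R n) => //.
    by exists x; split; rewrite /cell /= in_itv /= ?i1 ?j1 ltW.
  - rewrite (eq_bigr (fun=> n.+1%:R^-1))// => k Sk.
    by rewrite /r /l Sk -mulrBl -natrB ?leqnSn// subSnn mul1r.
have [f [f0 ffin fint fE]] := radon_nikodym_sigma_finite numu.
exists (fine \o f).
  rewrite (_ : EFin \o _ = f)//; apply/funext => x /=; exact: fineK.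
move=> t /andP[t0 t1].
have mt : measurable (`[0, t]%classic : set (measurableTypeR R)) by exact: measurable_itv.
rewrite /Rintegral; under eq_integral do rewrite /= fineK//.
have nuE : nu `[0, t]%classic = (F t - F 0)%:E.
  rewrite /nu /mfrestr /mrestr (_ : `[0, t] `&` `]0, 1] = `]0, t]%classic).
    by rewrite oc// /Fc !clamp01_id ?lexx ?t0 ?t1 ?ler01.
  apply/seteqP; split => x /=; rewrite !in_itv /=.
    by move=> [/andP[_ ->] /andP[-> _]].
  by move=> /andP[x0 xt]; rewrite ltW// xt x0 (le_trans xt).
by rewrite -fE// [X in fine X]nuE.
Unshelve. all: by end_near. Qed.
End ac_density.

Section ac_ftc.
Context {R : realType}.
Notation mu := (@lebesgue_measure R).

(** The total variation T of v on [0, x] and T - v are both nondecreasing and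
    absolutely continuous; their densities give that of v, and v has it as
    derivative at its Lebesgue points. *)
Lemma abs_continuous_ftc (v : R -> R) : abs_continuous 0 1 v ->
  exists g : R -> R, [/\ mu.-integrable setT (EFin \o g),
    forall t, 0 <= t <= 1 -> v t - v 0 = \int[mu]_(x in `[0, t]) g x &
    {ae mu, forall x, 0 < x < 1 -> has_deriv v x (g x)}].
Proof.
move=> acv; pose T x := fine (total_variation 0 x v).
have BV := abs_continuous_bounded_variation ler01 acv.
have acT : abs_continuous 0 1 T by exact: abs_continuous_total_variation.
have acW : abs_continuous 0 1 (fun x => T x - v x) by exact: abs_continuousB.
have TVfin x y : 0 <= x -> x <= y -> y <= 1 -> total_variation x y v \is a fin_num.
  move=> ax xy yb; apply/(bounded_variationP _ xy).
  exact: (bounded_variationl xy yb (bounded_variationr ax (le_trans xy yb) BV)).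
have Tvar x y : x \in `[0, 1] -> y \in `[0, 1] -> x <= y -> `|v y - v x| <= T y - T x.
  rewrite !in_itv /= => /andP[x0 x1] /andP[y0 y1] xy.
  rewrite /T (total_variationD v x0 xy) fineD ?TVfin// addrAC subrr add0r.
  by rewrite -lee_fin fineK ?TVfin// total_variation_ge.
have ndT : {in `[0, 1] &, {homo T : x y / x <= y}}.
  by move=> x y x01 y01 /(Tvar _ _ x01 y01); rewrite -subr_ge0; exact: le_trans.
have ndW : {in `[0, 1] &, {homo (fun x => T x - v x) : x y / x <= y}}.
  move=> x y x01 y01 /(Tvar _ _ x01 y01) h.
  by have := le_trans (ler_norm _) h; lra.
have [f intf fE] := nondecreasing_abs_continuous_density acT ndT.
have [h inth hE] := nondecreasing_abs_continuous_density acW ndW.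
pose g x := f x - h x.
have intg : mu.-integrable setT (EFin \o g).
  rewrite (_ : EFin \o g = (EFin \o f) \- (EFin \o h))%E; last exact/funext.
  exact: integrableB.
have gE t : 0 <= t <= 1 -> v t - v 0 = \int[mu]_(x in `[0, t]) g x.
  move=> t01; rewrite RintegralB//; last 2 first.
  - exact: integrableS intf.
  - exact: integrableS inth.
  by rewrite -fE// -hE//; ring.
exists g; split => //.
have loc : locally_integrable setT g.
  exact: (open_integrable_locally openT).
have intgy y : mu.-integrable [set` Interval (BLeft 0) (BRight y)] (EFin \o g).
  by apply: integrableS intg.
have := FTC1 intgy loc.
apply: filterS; first exact: (ae_filter_ringOfSetsType mu).
move=> x H /andP[x0 x1].
have [|dF F'] := H; first by rewrite (@lte_fin R).
rewrite derive1E in F'.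
apply: (has_deriv_eq _ (addr0 (g x))).
apply: near_eq_has_deriv (has_derivD (conj dF F') (has_deriv_cst (v 0) x)).
near=> y; rewrite -gE ?subrK//.
have : y \in `]0, 1[ by near: y; apply: near_in_itvoo; rewrite in_itv /= x0.
by rewrite in_itv /= => /andP[/ltW -> /ltW ->].
Unshelve. all: by end_near.
Qed.
End ac_ftc.

(** * Inverting the half-integral *)
Section abel.
Context {R : realType}.
Notation mu := (@lebesgue_measure R).

(** Gamma(1/2) times the half-integral of a scalar function. *)
Definition abel (g : R -> R) (t : R) : R :=
  \int[mu]_(s in `[0, t]) ((t - s) `^ (- 2^-1) * g s).

Definition abel_integrable (g : R -> R) (t : R) : Prop :=
  mu.-integrable `[0, t] (EFin \o (fun s => (t - s) `^ (- 2^-1) * g s)).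

Lemma integral_abel_beta (r t : R) : r < t ->
  mu.-integrable `[r, t]
    (EFin \o (fun s => (t - s) `^ (- 2^-1) * (s - r) `^ (- 2^-1))) /\
  (\int[mu]_(s in `[r, t]) ((t - s) `^ (- 2^-1) * (s - r) `^ (- 2^-1))%:E = pi%:E)%E.
Proof.
move=> rt; have [int Eint] := Rintegral_abel_beta rt.
have E : {in `[r, t]%classic, (fun s => (Num.sqrt (t - s))^-1 * (Num.sqrt (s - r))^-1)
    =1 (fun s => (t - s) `^ (- 2^-1) * (s - r) `^ (- 2^-1))}.
  by move=> s; rewrite inE /= in_itv /= => /andP[rs st]; rewrite !powR_Nhalf ?subr_ge0.
split.
  apply: eq_integrable int => // s sI /=; congr EFin; exact: E.
rewrite -Eint /Rintegral fineK; last exact: integrable_fin_num int.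
by apply: eq_integral => s sI; congr EFin; rewrite E.
Qed.

(* The kernel product of the iterated integral, supported on 0 <= r <= s <= t. *)
Let K (t : R) (g : R -> R) (z : R * R) : R :=
  if (0 <= z.1) && (z.1 <= z.2) && (z.2 <= t) then
  (t - z.2) `^ (- 2^-1) * ((z.2 - z.1) `^ (- 2^-1) * g z.1) else 0.

Let measurable_K t g : measurable_fun setT g -> measurable_fun setT (K t g).
Proof.
move=> mg; apply: measurable_fun_ifT => //.
- apply: measurable_and; first apply: measurable_and.
  + by apply: measurable_fun_ler.
  + by apply: measurable_fun_ler.
  + by apply: measurable_fun_ler.
- apply: measurable_funM.
    apply: (measurableT_comp (measurable_powR _)).
    exact: measurable_funB.
  apply: measurable_funM; last exact: measurableT_comp.
  apply: (measurableT_comp (measurable_powR _)).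
  exact: measurable_funB.
Qed.

Let section_K2 t g r : (fun s => (K t g (r, s))%:E) =
  ((fun s => ((t - s) `^ (- 2^-1) * (s - r) `^ (- 2^-1) * (g r * (0 <= r)%R%:R))%:E) \_ `[r, t])%E.
Proof.
apply/funext => s; rewrite patchE /K /=; case: ifPn => [/andP[/andP[r0 rs] st]|h].
  by rewrite mem_set/= ?in_itv/= ?rs// r0 mulr1 mulrA.
case: ifPn => //; rewrite inE /= in_itv /= => /andP[rs st].
by move: h; rewrite rs st !andbT => /negbTE ->; rewrite !mulr0.
Qed.

Let section_K1 t g s : (fun r => (K t g (r, s))%:E) =
  ((fun r => ((t - s) `^ (- 2^-1) * (s <= t)%R%:R * ((s - r) `^ (- 2^-1) * g r))%:E) \_ `[0%R, s])%E.
Proof.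
apply/funext => r; rewrite patchE /K /=; case: ifPn => [/andP[rs st]|h].
  by rewrite mem_set/= ?in_itv//= st mulr1.
case: ifPn => //; rewrite inE /= in_itv /= => rs.
by move: h; rewrite rs /= => /negbTE ->; rewrite mulr0 mul0r.
Qed.

Let integral_K2 t g r :
  (\int[mu]_s (K t g (r, s))%:E = (pi * ((g r * (0 <= r)%R%:R) * (r < t)%R%:R))%:E)%E.
Proof.
rewrite section_K2 -integral_mkcond.
have [rt|tr] := ltP r t; last first.
  rewrite !mulr0; have [->|rt] := eqVneq r t; first by rewrite set_itv1 integral_set1.
  by rewrite set_itv_ge ?integral_set0// bnd_simp -ltNge lt_neqAle eq_sym rt.
have [intk Ek] := integral_abel_beta rt.
under eq_integral do rewrite EFinM.
by rewrite integralZr// Ek mulr1 -EFinM.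
Qed.

Let integrable_K t g : mu.-integrable setT (EFin \o g) ->
  (mu \x mu)%E.-integrable setT (EFin \o K t g).
Proof.
move=> intg; have mg : measurable_fun setT g.
  by apply/measurable_EFinP; exact: measurable_int intg.
apply/integrable12ltyP.
  by apply/measurable_EFinP; exact: measurable_K.
have /integrableP[_ fing] := integrableZl measurableT pi intg.
apply: le_lt_trans fing; apply: ge0_le_integral => //.
- by move=> r _; apply: integral_ge0.
- apply: (@measurable_fun_fubini_tonelli_F _ _ _ _ R mu (fun z => `|(K t g z)%:E|%E)) => //.
  by apply: measurableT_comp => //; apply/measurable_EFinP; exact: measurable_K.
- apply: measurableT_comp => //; apply/measurable_EFinP.
  by apply: measurable_funM => //; exact: measurable_cst.
move=> r _.
have -> : (fun s => `|(EFin \o K t g) (r, s)|)%E =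
   (fun s => (K t (fun x => `|g x|) (r, s))%:E)%E.
  apply/funext => s /=; rewrite /K /=; case: ifP => _; last by rewrite normr0.
  by rewrite !normrM !(ger0_norm (powR_ge0 _ _)).
rewrite integral_K2 lee_fin normrM (ger0_norm (pi_ge0 R)) ler_wpM2l ?pi_ge0//.
rewrite -mulrA ler_piMr//.
by rewrite -natrM lern1; case: (_ <= _); case: (_ < _).
Qed.

(** Exchanging the two integrations turns the product of the two kernels into
    the Beta integral, which does not depend on the endpoints. *)
Lemma abel_abel (g : R -> R) (t : R) : 0 < t -> mu.-integrable setT (EFin \o g) ->
  (forall s, 0 < s <= t -> abel_integrable g s) ->
  abel (abel g) t = pi * \int[mu]_(s in `[0, t]) g s.
Proof.
move=> t0 intg intk.
have mt : measurable `[0, t]%classic by exact: measurable_itv.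
have intgt : mu.-integrable `[0, t] (EFin \o g) by apply: integrableS intg.
have := Fubini (integrable_K t intg).
rewrite [RHS](_ : _ = (\int[mu]_(s in `[0%R, t]) ((t - s) `^ (- 2^-1) * abel g s)%:E)%E); last first.
  rewrite [RHS]integral_mkcond; apply: eq_integral => s _.
  rewrite [LHS](_ : _ = \int[mu]_r (K t g (r, s))%:E)%E// section_K1 -integral_mkcond patchE.
  case: ifPn => [|]; rewrite ?notin_setE ?inE /= in_itv /=.
    move=> /andP[]; rewrite le_eqVlt => /predU1P[<- _|s0 st].
      by rewrite set_itv1 integral_set1 /abel set_itv1 Rintegral_set1 mulr0.
    rewrite st mulr1; under eq_integral do rewrite EFinM.
    have ints := intk s; rewrite s0 st in ints; have {}ints := ints isT.
    rewrite integralZl// EFinM; congr (_ * _)%E.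
    by rewrite /abel /Rintegral fineK//; exact: integrable_fin_num ints.
  move=> /negP; rewrite negb_and -!ltNge => /orP[s0|ts].
    by rewrite set_itv_ge ?integral_set0// bnd_simp -ltNge.
  rewrite leNgt ts mulr0; apply: integral0_eq => r _; by rewrite mul0r.
rewrite [LHS](_ : _ = (\int[mu]_(r in `[0%R, t]) (pi * g r)%:E)%E); last first.
  rewrite -(integral_itv_bndo_bndc (r := t)); last first.
    apply/measurable_EFinP; apply: measurable_funM; first exact: measurable_cst.
    by apply: measurable_funTS; apply/measurable_EFinP; exact: measurable_int intg.
  rewrite [RHS]integral_mkcond; apply: eq_integral => r _.
  rewrite [LHS](_ : _ = \int[mu]_s (K t g (r, s))%:E)%E// integral_K2 patchE.
  case: ifPn => [|]; rewrite ?notin_setE ?inE /= in_itv /=.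
    by move=> /andP[-> ->]; rewrite !mulr1.
  by move=> /negP; case: (0 <= r); case: (r < t) => //= _; rewrite !(mulr0, mul0r).
move=> E; rewrite {1}/abel /Rintegral -E.
rewrite -[X in _ * X]/(Rintegral mu `[0, t]%classic g) -RintegralZl//.
Qed.

End abel.

(** * Smooth functions of one variable *)
Section smooth1.
Context {R : realType}.
Implicit Types (f g : R -> R).

Fixpoint Cn (n : nat) f : Prop :=
  if n is m.+1 then exists2 f' : R -> R, forall x, has_deriv f x (f' x) & Cn m f'
  else True.

Definition smooth1 f := forall n, Cn n f.

Lemma CnW n f : Cn n.+1 f -> Cn n f.
Proof.
elim: n f => // n IH f [f' df Cf']; exists f' => //; exact: IH.
Qed.

Lemma Cn_eq n f g : f =1 g -> Cn n f -> Cn n g.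
Proof. by move=> /funext ->. Qed.

Lemma CnD n f g : Cn n f -> Cn n g -> Cn n (fun x => f x + g x).
Proof.
elim: n f g => // n IH f g [f' df Cf] [g' dg Cg].
by exists (fun x => f' x + g' x) => [x|]; [exact: has_derivD|exact: IH].
Qed.

Lemma CnN n f : Cn n f -> Cn n (fun x => - f x).
Proof.
elim: n f => // n IH f [f' df Cf].
by exists (fun x => - f' x) => [x|]; [exact: has_derivN|exact: IH].
Qed.

Lemma CnM n f g : Cn n f -> Cn n g -> Cn n (fun x => f x * g x).
Proof.
elim: n f g => // n IH f g Cf Cg; have [[f' df Cf'] [g' dg Cg']] := (Cf, Cg).
exists (fun x => f' x * g x + f x * g' x) => [x|]; first exact: has_derivM.
by apply: CnD; apply: IH => //; exact: CnW.
Qed.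

Lemma Cn_comp n f g : Cn n f -> Cn n g -> Cn n (fun x => f (g x)).
Proof.
elim: n f g => // n IH f g [f' df Cf'] Cg; have [g' dg Cg'] := Cg.
exists (fun x => f' (g x) * g' x) => [x|]; first exact: has_deriv_comp.
by apply: CnM => //; apply: IH => //; exact: CnW.
Qed.

Lemma CnV n f : (forall x, f x != 0) -> Cn n f -> Cn n (fun x => (f x)^-1).
Proof.
move=> f0; elim: n => // n IH Cf; have [f' df Cf'] := Cf.
exists (fun x => - (f' x * ((f x)^-1 * (f x)^-1))) => [x|].
  by apply: has_deriv_eq (has_derivV (f0 x) (df x)) _; rewrite -invfM expr2.
apply/CnN/CnM => //; apply: CnM; apply: IH; exact: CnW.
Qed.

Lemma smooth1_cst c : smooth1 (fun=> c).
Proof.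
move=> n; elim: n c => // n IH c; exists (fun=> 0) => // x; exact: has_deriv_cst.
Qed.

Lemma smooth1_id : smooth1 (fun x => x).
Proof.
case=> // n; exists (fun=> 1); [exact: has_deriv_id|exact: smooth1_cst].
Qed.

Lemma smooth1D f g : smooth1 f -> smooth1 g -> smooth1 (fun x => f x + g x).
Proof. by move=> sf sg n; exact: CnD. Qed.

Lemma smooth1M f g : smooth1 f -> smooth1 g -> smooth1 (fun x => f x * g x).
Proof. by move=> sf sg n; exact: CnM. Qed.

Lemma smooth1X n : smooth1 (fun x => x ^+ n).
Proof.
elim: n => [|n IH k]; first exact: smooth1_cst.
apply: (@Cn_eq _ (fun x => x * x ^+ n)) => [x|]; first by rewrite exprS.
by apply: smooth1M => //; exact: smooth1_id.
Qed.

Lemma smooth1_deriv f : smooth1 f ->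
  smooth1 (derive1 f) /\ forall x, has_deriv f x (derive1 f x).
Proof.
move=> sf; have df x : has_deriv f x (derive1 f x).
  by have [f' df _] := sf 1%N; rewrite (has_deriv_derive1 (df x)).
split=> // n; have [f' df' Cf'] := sf n.+1.
by apply: Cn_eq Cf' => x; rewrite (has_deriv_derive1 (df' x)).
Qed.

Lemma has_deriv_continuousT f f' : (forall x, has_deriv f x (f' x)) -> continuous f.
Proof. by move=> df x; exact: has_deriv_continuous (df x). Qed.

Lemma smooth1_continuous f : smooth1 f -> continuous f.
Proof. by move=> /(_ 1%N)[f' df _]; exact: has_deriv_continuousT df. Qed.

(** The functions q(1/x) exp(-1/x), extended by 0: a family closed under
    differentiation, which makes the classical flat function smooth. *)
Definition flat (q : {poly R}) (x : R) : R :=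
  if 0 < x then q.[x^-1] * expR (- x^-1) else 0.

Lemma poly_le_expR (q : {poly R}) :
  exists C : R, forall y, 0 <= y -> `|q.[y]| <= C * expR y.
Proof.
exists (\sum_(i < size q) `|q`_i| * i`!%:R) => y y0.
rewrite horner_coef mulr_suml; apply: le_trans (ler_norm_sum _ _ _) _.
apply: ler_sum => i _; rewrite normrM -mulrA ler_wpM2l// ger0_norm ?exprn_ge0//.
case: (nat_of_ord i) => [|n].
  by rewrite expr0 fact0 mul1r; apply: le_trans (expR_ge1Dx y); rewrite lerDl.
rewrite mulrC -ler_pdivrMr ?ltr0n ?fact_gt0//.
by apply: le_trans (expR_ge1Dxn n y0); rewrite lerDr.
Qed.

Lemma quadratic_has_deriv0 f (C : R) : (forall x, `|f x| <= C * x ^+ 2) ->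
  has_deriv f 0 0.
Proof.
move=> fC; have f0 : f 0 = 0.
  by apply/eqP; rewrite -normr_le0 (le_trans (fC 0))// expr0n mulr0.
suff H : h^-1 *: ((f \o shift 0) (h *: 1) - f 0) @[h --> 0^'] --> (0 : R).
  split; first by apply/cvg_ex; exists 0.
  exact: cvg_lim H.
apply/cvgrPdist_le => e e0; near=> h.
rewrite sub0r normrN f0 subr0 /= addr0 normrM [_%:A]mulr1.
have h0 : h != 0 by near: h; exact: nbhs_dnbhs_neq.
have hC : `|h| <= e / (`|C| + 1).
  by near: h; apply: dnbhs0_le; rewrite divr_gt0// ltr_wpDl.
have Ch : `|C| * `|h| <= e.
  rewrite ler_pdivlMr ?ltr_wpDl// mulrDr mulr1 in hC.
  by apply: le_trans hC; rewrite mulrC lerDl.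
rewrite normfV mulrC ler_pdivrMr ?normr_gt0//.
apply: le_trans (fC h) _; rewrite -(real_normK (num_real h)) expr2 mulrA.
by rewrite ler_wpM2r// (le_trans _ Ch)// ler_wpM2r// ler_norm.
Unshelve. all: by end_near. Qed.

Lemma has_deriv_poly (q : {poly R}) x : has_deriv (horner q) x (q^`())%R.[x].
Proof. by apply/has_derivP; exact: is_derive_poly. Qed.

(** The chain rule for q(y) exp(-y) at y = 1/x. *)
Definition flat_deriv (q : {poly R}) : {poly R} := 'X^2 * (q - q^`())%R.

Lemma has_deriv_flat (q : {poly R}) x : has_deriv (flat q) x (flat (flat_deriv q) x).
Proof.
have [x0|x0|->] := ltgtP x 0.
- rewrite {2}/flat ltNge (ltW x0) /=.
  apply: near_eq_has_deriv (has_deriv_cst 0 x).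
  near=> y; rewrite /flat ifF//; apply/negbTE; rewrite -leNgt ltW//.
  by near: y; exact: lt_nbhsl.
- rewrite {2}/flat x0.
  apply: (@near_eq_has_deriv _ (fun y => q.[y^-1] * expR (- y^-1))).
    near=> y; rewrite /flat ifT//; by near: y; exact: lt_nbhsr.
  have xn0 : x != 0 by rewrite gt_eqF.
  have dV := has_derivV xn0 (has_deriv_id x).
  apply: has_deriv_eq.
    apply: has_derivM; first exact: has_deriv_comp (has_deriv_poly q _) dV.
    by apply: has_deriv_expR; exact: has_derivN dV.
  rewrite /flat_deriv hornerM hornerXn hornerD hornerN /=.
  by move: q.[x^-1] q^`().[x^-1] (expR _) => a b e; field.
- rewrite {2}/flat ltxx {x}.
  have [C hC] := poly_le_expR ('X^2 * q).
  apply: (@quadratic_has_deriv0 _ `|C|) => x; rewrite /flat.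
  case: ifPn => x0; last by rewrite normr0 mulr_ge0// sqr_ge0.
  have xi0 : 0 < x^-1 by rewrite invr_gt0.
  have := hC _ (ltW xi0); rewrite hornerM hornerXn normrM (ger0_norm (sqr_ge0 _)).
  rewrite normrM (ger0_norm (expR_ge0 _)) expRN ler_pdivrMr ?expR_gt0// => h.
  rewrite -(ler_pM2l (exprn_gt0 2 xi0)) (le_trans h)//.
  rewrite [leRHS](_ : _ = (x^-1 * x) ^+ 2 * (`|C| * expR x^-1)); last by ring.
  by rewrite mulVf ?gt_eqF// expr1n mul1r ler_wpM2r ?expR_ge0// ler_norm.
Unshelve. all: by end_near. Qed.

Lemma smooth1_flat q : smooth1 (flat q).
Proof.
move=> n; elim: n q => // n IH q.
by exists (flat (flat_deriv q)) => // x; exact: has_deriv_flat.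
Qed.

Lemma flat1_gt0 x : 0 < x -> 0 < flat 1 x.
Proof. by move=> x0; rewrite /flat x0 hornerC mul1r expR_gt0. Qed.

Lemma flat_le0 q x : x <= 0 -> flat q x = 0.
Proof. by rewrite /flat ltNge => ->. Qed.

Lemma flat1_ge0 x : 0 <= flat 1 x.
Proof.
by have [/flat_le0 ->|/flat1_gt0/ltW] := leP x 0.
Qed.

(** The two flat terms vanish for 4 <= x^2 and for x^2 <= 2 respectively, never
    together, so the denominator is positive everywhere. *)
Definition plateau (x : R) : R :=
  flat 1 (4 - x ^+ 2) * (flat 1 (4 - x ^+ 2) + flat 1 (x ^+ 2 - 2))^-1.

Lemma plateau_den_gt0 x : 0 < flat 1 (4 - x ^+ 2) + flat 1 (x ^+ 2 - 2).
Proof.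
have [x2|x2] := ltP (x ^+ 2) 4.
  by rewrite ltr_wpDr ?flat1_ge0// flat1_gt0// subr_gt0.
by rewrite ltr_wpDl ?flat1_ge0// flat1_gt0// subr_gt0 (lt_le_trans _ x2)// ltr_nat.
Qed.

Lemma plateau1 x : x ^+ 2 <= 2 -> plateau x = 1.
Proof.
move=> x2; rewrite /plateau (@flat_le0 1 (x ^+ 2 - 2)) ?subr_le0// addr0 divff//.
by rewrite gt_eqF// flat1_gt0// subr_gt0 (le_lt_trans x2)// ltr_nat.
Qed.

Lemma plateau0 x : 4 <= x ^+ 2 -> plateau x = 0.
Proof. by move=> x4; rewrite /plateau flat_le0 ?mul0r// subr_le0. Qed.

Lemma smooth1_plateau : smooth1 plateau.
Proof.
have s2 c d : smooth1 (fun x => c + d * x ^+ 2).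
  apply: smooth1D; first exact: smooth1_cst.
  by apply: smooth1M; [exact: smooth1_cst|exact: smooth1X].
have sA : smooth1 (fun x => flat 1 (4 - x ^+ 2)).
  move=> n; apply: (@Cn_eq _ (fun x => flat 1 (4 + (-1) * x ^+ 2))) => [x|].
    by rewrite mulN1r.
  by apply: Cn_comp; [exact: smooth1_flat|exact: s2].
have sB : smooth1 (fun x => flat 1 (x ^+ 2 - 2)).
  move=> n; apply: (@Cn_eq _ (fun x => flat 1 (- 2 + 1 * x ^+ 2))) => [x|].
    by rewrite mul1r addrC.
  by apply: Cn_comp; [exact: smooth1_flat|exact: s2].
apply: smooth1M => // n; apply: CnV => [x|]; first by rewrite gt_eqF// plateau_den_gt0.
exact: smooth1D.
Qed.

End smooth1.

(** * Smooth compactly supported functions of two variables *)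
Section test_functions.
Context {R : realType}.
Implicit Types (f g : R -> R) (F G : 'rV[R]_2 -> R).

Definition test1 f := smooth1 f /\ forall x, 4 < x ^+ 2 -> f x = 0.

Lemma test1_plateauM f : smooth1 f -> test1 (fun x => f x * plateau x).
Proof.
move=> sf; split=> [|x x4]; first by apply: smooth1M => //; exact: smooth1_plateau.
by rewrite plateau0 ?mulr0// ltW.
Qed.

Lemma test1_plateau : test1 (@plateau R).
Proof. by split=> [|x x4]; [exact: smooth1_plateau|rewrite plateau0// ltW]. Qed.

Lemma test1_deriv f : test1 f -> test1 (derive1 f).
Proof.
move=> [sf f0]; have [sf' df] := smooth1_deriv sf; split=> // x x4.
apply: has_deriv_derive1; apply: (@near_eq_has_deriv _ (fun=> 0)) (has_deriv_cst 0 x).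
have : {for x, continuous (fun y : R => y ^+ 2)} by exact: exprn_continuous.
move=> /(_ _ (lt_nbhsr x4)) H; near=> y; rewrite f0//.
by near: y; exact: H.
Unshelve. all: by end_near.
Qed.

Lemma test1_bounded f : test1 f -> exists2 B, 0 <= B & forall x, `|f x| <= B.
Proof.
move=> [/smooth1_continuous cf f0].
have [|c _ hc] := @EVT_max R (fun x => `|f x|) (-2) 2 ltac:(lra).
  apply: continuous_subspaceT => x.
  by apply: (@continuous_comp _ _ _ f Num.norm); [exact: cf|exact: norm_continuous].
exists `|f c| => // x; have [x4|x4] := ltP 4 (x ^+ 2); first by rewrite f0 ?normr0.
apply: hc; rewrite in_itv /=; apply/andP; split; nra.
Qed.

Lemma test1_lipschitz f : test1 f ->
  exists2 L, 0 <= L & forall x y, `|f x - f y| <= L * `|x - y|.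
Proof.
move=> tf; have [L L0 hL] := test1_bounded (test1_deriv tf).
have [_ df] := smooth1_deriv tf.1.
exists L => // x y; wlog xy : x y / y <= x.
  by move=> W; have [/W//|/ltW/W] := leP y x; rewrite distrC [X in _ * X]distrC.
have [|z _ ->] := @MVT_segment R f (derive1 f) y x xy (fun z _ => (has_derivP _ _ _).1 (df z)).
  by apply: continuous_subspaceT; exact: smooth1_continuous tf.1.
by rewrite normrM ler_wpM2r.
Qed.

(** Finite sums of products of one-variable test functions. The class is closed
    under both partial derivatives, and every estimate on it reduces to one
    variable. *)
Inductive tensor : ('rV[R]_2 -> R) -> Prop :=
| tensorM f g : test1 f -> test1 g -> tensor (fun x => f (x 0 0) * g (x 0 1))
| tensorD F G : tensor F -> tensor G -> tensor (fun x => F x + G x).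

Lemma directional_deriv (F : 'rV[R]_2 -> R) (x v : 'rV[R]_2) (a : R) :
  has_deriv (fun h => F (h *: v + x)) 0 a -> derivable F x v /\ 'D_v F x = a.
Proof.
have E : (fun h => h^-1 *: (((fun h => F (h *: v + x)) \o shift 0) (h *: 1) -
    F (0 *: v + x))) = (fun h => h^-1 *: ((F \o shift x) (h *: v) - F x)).
  by apply/funext => h /=; rewrite addr0 [_%:A]mulr1 scale0r add0r.
by rewrite /has_deriv /derivable /derive E.
Qed.

Lemma tensor_partial F : tensor F -> forall i, exists2 G, tensor G &
  forall x, has_deriv (fun h => F (h *: delta_mx 0 i + x)) 0 (G x).
Proof.
elim=> [f g tf tg i|{}F G _ IHF _ IHG i]; last first.
  have [F' tF' dF'] := IHF i; have [G' tG' dG'] := IHG i.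
  by exists (fun x => F' x + G' x) => [|x]; [exact: tensorD|exact: has_derivD].
have [_ df] := smooth1_deriv tf.1; have [_ dg] := smooth1_deriv tg.1.
have coordE (x : 'rV[R]_2) h j :
    (h *: delta_mx 0 i + x) 0 j = h * (j == i)%:R + x 0 j.
  by rewrite !mxE eqxx.
have dcoord (k : R -> R) (c d : R) : (forall y, has_deriv k y (derive1 k y)) ->
    has_deriv (fun h => k (h * c + d)) 0 (derive1 k d * c).
  move=> dk; apply: has_deriv_eq.
    apply: (@has_deriv_comp _ k); first exact: dk.
    apply: has_derivD (has_deriv_cst d 0).
    exact: has_derivM (has_deriv_id 0) (has_deriv_cst c 0).
  by rewrite !mul0r !add0r mul1r !addr0.
have := ltn_ord i; case: i coordE => -[|[|//]] i2 coordE _.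
- exists (fun x => derive1 f (x 0 0) * g (x 0 1)).
    by apply: tensorM => //; exact: test1_deriv.
  move=> x; have H := has_derivM (dcoord f 1 (x 0 0) df) (has_deriv_cst (g (x 0 1)) 0).
  apply: has_deriv_eq; first apply: eq_has_deriv H => h.
  by rewrite !coordE /= mulr0 add0r.
  by rewrite /=; ring.
- exists (fun x => f (x 0 0) * derive1 g (x 0 1)).
    by apply: tensorM => //; exact: test1_deriv.
  move=> x; have H := has_derivM (has_deriv_cst (f (x 0 0)) 0) (dcoord g 1 (x 0 1) dg).
  apply: has_deriv_eq; first apply: eq_has_deriv H => h.
  by rewrite !coordE /= mulr0 add0r.
  by rewrite /=; ring.
Qed.

Lemma tensor_partialE F i : tensor F ->
  tensor (partial i F) /\
  forall x, has_deriv (fun h => F (h *: delta_mx 0 i + x)) 0 (partial i F x).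
Proof.
move=> tF; have [G tG dG] := tensor_partial tF i.
have -> : partial i F = G.
  by apply/funext => x; exact: (directional_deriv (dG x)).2.
by [].
Qed.

Lemma tensor_continuous F : tensor F -> continuous F.
Proof.
elim=> [f g tf tg|{}F G _ cF _ cG] x.
  apply: (@continuousM _ _ (fun x : 'rV[R]_2 => f (x 0 0)) (fun x => g (x 0 1))).
    apply: (@continuous_comp _ _ _ (fun x : 'rV[R]_2 => x 0 0) f).
      exact: coord_continuous.
    exact: smooth1_continuous tf.1 _.
  apply: (@continuous_comp _ _ _ (fun x : 'rV[R]_2 => x 0 1) g).
    exact: coord_continuous.
  exact: smooth1_continuous tg.1 _.
by apply: continuousD; [exact: cF|exact: cG].
Qed.

Lemma tensor_smooth F : tensor F -> smooth F.
Proof.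
move=> tF s; have : tensor (iter_partial s F).
  by elim: s => //= i s /(tensor_partialE i)[].
move: (iter_partial s F) => G tG; split; first exact: tensor_continuous.
move=> i x; have [_ dG] := tensor_partialE i tG.
exact: (directional_deriv (dG x)).1.
Qed.

Lemma tensor_supp F (x : 'rV[R]_2) : tensor F -> 4 < x 0 0 ^+ 2 \/ 4 < x 0 1 ^+ 2 -> F x = 0.
Proof.
elim=> [f g [_ f0] [_ g0] [/f0 ->|/g0 ->]|{}F G _ IHF _ IHG h].
- by rewrite mul0r.
- by rewrite mulr0.
- by rewrite IHF// IHG// addr0.
Qed.

Lemma tensor_compactly_supported F : tensor F -> compactly_supported F.
Proof.
move=> tF; apply: bounded_closed_compact; last exact: closed_closure.
have sub : closure [set x | F x != 0] `<=` [set x : 'rV[R]_2 | `|x| <= 2].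
  rewrite closureE; apply: smallest_sub.
    apply: (@preimage_closed _ _ (fun x : 'rV[R]_2 => `|x|) [set y | y <= 2]).
      by move=> x _; exact: norm_continuous.
    exact: closed_le.
  move=> x /= /eqP Fx; rewrite leNgt; apply/negP => x2; apply: Fx.
  have [|[k i] /= xi] := @mx_norm_neq0 _ _ _ x.
    by rewrite gt_eqF// (lt_trans _ x2).
  apply: tensor_supp tF _; rewrite ord1 in xi.
  have : 4 < x 0 i ^+ 2.
    have : 2 < mx_norm x := x2.
    by rewrite -real_normK ?num_real// xi; nra.
  case: i {xi} => -[|[|//]] i2 h; [left|right]; move: h; congr (_ < x 0 _ ^+ 2);
    exact: val_inj.
exists 2; split => // M M2 x /sub /= /le_trans; apply; exact: ltW.
Qed.

Lemma tensor_bounded F : tensor F -> exists2 B, 0 <= B & forall x, `|F x| <= B.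
Proof.
elim=> [f g /test1_bounded[A A0 hA] /test1_bounded[B B0 hB]|].
  by exists (A * B) => [|x]; [exact: mulr_ge0|rewrite normrM ler_pM].
move=> {}F G _ [A A0 hA] _ [B B0 hB]; exists (A + B) => [|x]; first exact: addr_ge0.
by rewrite (le_trans (ler_normD _ _))// lerD.
Qed.

Lemma ler_coord_norm (x : 'rV[R]_2) i : `|x 0 i| <= `|x|.
Proof.
have -> : `|x| = \big[Num.max/0]_ij `|x ij.1 ij.2| by exact: mx_normrE.
exact: (le_bigmax _ (fun ij : 'I_1 * 'I_2 => `|x ij.1 ij.2|) (0, i)).
Qed.

Lemma tensor_lipschitz F : tensor F ->
  exists2 L, 0 <= L & forall x y, `|F x - F y| <= L * `|x - y|.
Proof.
elim=> [f g tf tg|].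
  have [A A0 hA] := test1_bounded tf; have [B B0 hB] := test1_bounded tg.
  have [K K0 hK] := test1_lipschitz tf; have [L L0 hL] := test1_lipschitz tg.
  exists (K * B + A * L) => [|x y]; first by rewrite addr_ge0// mulr_ge0.
  have -> : f (x 0 0) * g (x 0 1) - f (y 0 0) * g (y 0 1) =
    (f (x 0 0) - f (y 0 0)) * g (x 0 1) + f (y 0 0) * (g (x 0 1) - g (y 0 1)) by ring.
  have coord i : `|x 0 i - y 0 i| <= `|x - y|.
    by have := ler_coord_norm (x - y) i; rewrite !mxE.
  apply: le_trans (ler_normD _ _) _; rewrite !normrM mulrDl; apply: lerD.
    rewrite mulrAC ler_pM//.
    by apply: le_trans (hK _ _) _; rewrite ler_wpM2l.
  rewrite -mulrA ler_pM//.
  by apply: le_trans (hL _ _) _; rewrite ler_wpM2l.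
move=> {}F G _ [A A0 hA] _ [B B0 hB]; exists (A + B) => [|x y]; first exact: addr_ge0.
rewrite opprD addrACA mulrDl (le_trans (ler_normD _ _))// lerD//.
Qed.

End test_functions.

Section hessian.
Context {R : realType}.

(** If the entries are at most B in absolute value, the quadratic form is at
    least - 2 B |w|^2. *)
Lemma tensor_Hess_bounded_below (F : 'rV[R]_2 -> R) : tensor F ->
  exists L, forall x, loewner_le (- L)%:M (Hess F x).
Proof.
move=> tF; have bd i j : exists2 B, 0 <= B & forall x, `|Hess F x i j| <= B.
  have [B B0 hB] := tensor_bounded (tensor_partialE i (tensor_partialE j tF).1).1.
  by exists B => // x; rewrite mxE.
have [B B0 hB] : exists2 B, 0 <= B & forall x i j, `|Hess F x i j| <= B.
  have [A A0 hA] := bd 0 0; have [B B0 hB] := bd 0 1.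
  have [C C0 hC] := bd 1 0; have [D D0 hD] := bd 1 1.
  exists (A + B + C + D) => [|x i j]; first by rewrite !addr_ge0.
  have := hA x; have := hB x; have := hC x; have := hD x.
  by have [->|->] := ord2P i; have [->|->] := ord2P j; lra.
exists (2 * B) => x w.
have := hB x; move: (Hess F x) => H hH.
have E : (w *m (H - (- (2 * B))%:M) *m w^T) 0 0 =
    H 0 0 * w 0 0 ^+ 2 + (H 0 1 + H 1 0) * (w 0 0 * w 0 1) + H 1 1 * w 0 1 ^+ 2
    + 2 * B * (w 0 0 ^+ 2 + w 0 1 ^+ 2).
  by rewrite !mxE !sum_ord2 !mxE !sum_ord2 !mxE /= !mulr0n !mulr1n; ring.
rewrite E; have := hH 0 0; have := hH 0 1; have := hH 1 0; have := hH 1 1.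
rewrite !ler_norml.
move: (H 0 0) (H 0 1) (H 1 0) (H 1 1) (w 0 0) (w 0 1) => p q r s a b.
move=> /andP[s1 s2] /andP[r1 r2] /andP[q1 q2] /andP[p1 p2].
have m1 : 0 <= (p + B) * a ^+ 2 by apply: mulr_ge0; [lra|exact: sqr_ge0].
have m2 : 0 <= (s + B) * b ^+ 2 by apply: mulr_ge0; [lra|exact: sqr_ge0].
have m3 : 0 <= (q + r + 2 * B) * (a + b) ^+ 2 by apply: mulr_ge0; [lra|exact: sqr_ge0].
have m4 : 0 <= (2 * B - (q + r)) * (a - b) ^+ 2 by apply: mulr_ge0; [lra|exact: sqr_ge0].
lra.
Qed.

End hessian.

(** * Uniqueness *)
Section abel_estimates.
Context {R : realType}.
Notation mu := (@lebesgue_measure R).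

Lemma ae_eq_integrable_Rintegral (D : set R) (f g : R -> R) : measurable D ->
  measurable_fun D g -> {ae mu, forall x, D x -> f x = g x} ->
  mu.-integrable D (EFin \o f) ->
  mu.-integrable D (EFin \o g) /\ \int[mu]_(x in D) f x = \int[mu]_(x in D) g x.
Proof.
move=> mD mg fg /integrableP[mf fin].
have fg' : ae_eq mu D (EFin \o f) (EFin \o g).
  move: fg; apply: filterS; first exact: (ae_filter_ringOfSetsType mu).
  by move=> x fgx /fgx /= ->.
have mg' : measurable_fun D (EFin \o g) by exact/measurable_EFinP.
split; last by congr fine; exact: ae_eq_integral.
apply/integrableP; split=> //.
rewrite [ltLHS](_ : _ = \int[mu]_(x in D) `|(EFin \o f) x|)%E//.
apply: ae_eq_integral => //.
- exact: measurableT_comp.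
- exact: measurableT_comp.
- exact/ae_eq_sym/ae_eq_abse.
Qed.

Lemma integrable_eq_oc (f g : R -> R) (t : R) :
  (forall s, 0 < s <= t -> f s = g s) -> mu.-integrable `[0, t] (EFin \o f) ->
  mu.-integrable `[0, t] (EFin \o g) /\
  \int[mu]_(x in `[0, t]) f x = \int[mu]_(x in `[0, t]) g x.
Proof.
move=> fg intf; apply: ae_eq_integrable_Rintegral => //.
  apply/measurable_fun_itv_obnd_cbndP.
  apply: (@eq_measurable_fun _ _ _ _ _ f).
    by move=> s; rewrite inE /= in_itv /= => /fg.
  have /measurable_EFinP := measurable_int _ intf.
  by move/measurable_fun_itv_obnd_cbndP.
exists [set 0]; split; [exact: measurable_set1|exact: lebesgue_measure_set1|].
move=> s /= h; apply: contrapT => s0; apply: h; rewrite in_itv /= => /andP[s0' st].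
by apply: fg; rewrite st lt0r s0' !andbT; exact/eqP.
Qed.

Lemma measurable_kernel (t : R) (D : set R) :
  measurable_fun D (fun s : R => (t - s) `^ (- 2^-1)).
Proof.
apply: measurable_funTS; apply: (measurableT_comp (measurable_powR _)).
exact: measurable_funB.
Qed.

Lemma kernel_integrable (t : R) :
  mu.-integrable `[0, t] (EFin \o (fun s => (t - s) `^ (- 2^-1))).
Proof.
have [t0|t0] := ltP 0 t.
  apply: eq_integrable (Rintegral_abel_cst t0).1 => // s.
  by rewrite inE /= in_itv /= => /andP[_ st]; rewrite powR_Nhalf ?subr_ge0.
have [->|tn0] := eqVneq t 0.
  apply/integrableP; split; first by apply/measurable_EFinP; apply: (measurable_kernel 0).
  by rewrite set_itv1 integral_set1 ltry.
rewrite set_itv_ge; last by rewrite bnd_simp -ltNge lt_neqAle tn0.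
exact: integrable_set0.
Qed.

Lemma abel_integrable_bounded (h : R -> R) (t B : R) :
  measurable_fun `[0, t] h -> (forall s, 0 <= s <= t -> `|h s| <= B) ->
  abel_integrable h t.
Proof.
move=> mh hB; apply: (@le_integrable _ _ _ mu _ _ _ (fun s => (B * (t - s) `^ (- 2^-1))%:E)) => //.
- by apply/measurable_EFinP/measurable_funM => //; exact: measurable_kernel.
- move=> s; rewrite /= in_itv /= => st; rewrite lee_fin !normrM mulrC.
  by rewrite ler_wpM2r// (le_trans (hB _ st))// ler_norm.
- exact: integrableZl (kernel_integrable t).
Qed.

Lemma Rintegral_kernel (a t : R) : a <= t ->
  \int[mu]_(s in `[a, t]) (t - s) `^ (- 2^-1) = 2 * Num.sqrt (t - a).
Proof.
rewrite le_eqVlt => /predU1P[->|at'].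
  by rewrite set_itv1 Rintegral_set1 subrr sqrtr0 mulr0.
rewrite -(Rintegral_abel_cst at').2; apply: eq_Rintegral => s.
by rewrite inE /= in_itv /= => /andP[_ st]; rewrite powR_Nhalf ?subr_ge0.
Qed.

(** Where the two functions agree the kernel does not contribute, and on [a, t]
    its mass is only 2 sqrt (t - a). *)
Lemma abel_diff_le (h1 h2 : R -> R) (a t c : R) : 0 <= a <= t ->
  abel_integrable h1 t -> abel_integrable h2 t ->
  (forall s, 0 <= s < a -> h1 s = h2 s) ->
  (forall s, a <= s <= t -> `|h1 s - h2 s| <= c) ->
  `|abel h1 t - abel h2 t| <= c * (2 * Num.sqrt (t - a)).
Proof.
move=> /andP[a0 at'] i1 i2 h0 hc.
have sub : `[a, t]%classic `<=` `[0, t]%classic by apply: subset_itvr; rewrite bnd_simp.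
pose k s := (t - s) `^ (- 2^-1).
have intk : mu.-integrable `[a, t] (EFin \o k).
  by apply: integrableS (kernel_integrable t).
have c0 : 0 <= c by apply: le_trans (hc t _); rewrite ?lexx ?at'.
have int12 : mu.-integrable `[0, t] (EFin \o (fun s => k s * h1 s - k s * h2 s)).
  rewrite (_ : EFin \o _ = (EFin \o (fun s => k s * h1 s)%R) \-
    (EFin \o (fun s => k s * h2 s)%R))%E; last exact/funext.
  exact: integrableB.
rewrite /abel -RintegralB// (le_trans (le_normr_Rintegral _ _))//.
have -> : c * (2 * Num.sqrt (t - a)) = \int[mu]_(s in `[a, t]) (c * k s).
  by rewrite RintegralZl// Rintegral_kernel.
rewrite [leRHS](_ : _ = \int[mu]_(s in `[0, t]) (((fun s => c * k s) \_ `[a, t]) s)); last first.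
  by rewrite -Rintegral_mkcondr setIidr.
apply: le_Rintegral => //.
- exact: (integrable_norm int12).
- rewrite -restrict_EFin; apply/integrable_restrict => //.
  rewrite setIidr//; rewrite (_ : EFin \o _ = (fun s => c%:E * (EFin \o k) s)%E)//.
  exact: integrableZl.
- move=> s; rewrite /= in_itv /= => /andP[s0 st]; rewrite patchE.
  case: ifPn => [|]; rewrite ?notin_setE ?inE /= in_itv /= st andbT.
    move=> as'; rewrite -mulrBr normrM (ger0_norm (powR_ge0 _ _)) mulrC.
    by rewrite ler_wpM2r ?powR_ge0// hc// as'.
  by move=> /negP; rewrite -ltNge => sa; rewrite h0 ?s0// subrr normr0.
Qed.

End abel_estimates.

Section uniqueness.
Context {R : realType}.
Notation mu := (@lebesgue_measure R).
Implicit Types (E : 'rV[R]_2 -> R) (u v : R -> 'rV[R]_2).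

Lemma half_integralE (f : R -> 'rV[R]_2) t i :
  half_integral f t 0 i = (Gamma (2^-1 : R))^-1 * abel (fun s => f s 0 i) t.
Proof. by rewrite !mxE. Qed.

Lemma half_integral_grad E v t i : half_integral (grad E \o v) t 0 i =
  (Gamma (2^-1 : R))^-1 * abel (fun s => partial i E (v s)) t.
Proof.
rewrite half_integralE; congr (_ * abel _ t).
by apply/funext => s; rewrite /grad /= mxE.
Qed.

Lemma half_integral0 (f : R -> 'rV[R]_2) : half_integral f 0 = 0.
Proof.
by apply/rowP => i; rewrite half_integralE /abel set_itv1 Rintegral_set1 mulr0 mxE.
Qed.

Lemma norm_rV_le (x : 'rV[R]_2) (c : R) : 0 <= c ->
  (forall i, `|x 0 i| <= c) -> `|x| <= c.
Proof.
move=> c0 h; have -> : `|x| = \big[Num.max/0]_ij `|x ij.1 ij.2| by exact: mx_normrE.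
by apply: bigmax_le => // -[k i] _ /=; rewrite ord1.
Qed.

Lemma partial_comp_measurable E v i (t : R) : tensor E -> {within `[0, 1], continuous v} ->
  t <= 1 -> measurable_fun `[0, t] (fun s => partial i E (v s)).
Proof.
move=> tE cv t1.
suff : measurable_fun `[(0 : R), 1] (fun s => partial i E (v s)).
  by apply: measurable_funS => //; apply: subset_itvl; rewrite bnd_simp.
apply: subspace_continuous_measurable_fun => // s.
apply: (@continuous_comp _ _ _ (v : subspace `[0, 1] -> _) (partial i E)); first exact: cv.
exact: tensor_continuous (tensor_partialE i tE).1 _.
Qed.

Lemma partial_comp_abel_integrable E v i (t : R) : tensor E ->
  {within `[0, 1], continuous v} -> t <= 1 ->
  abel_integrable (fun s => partial i E (v s)) t.
Proof.
move=> tE cv t1; have [B _ hB] := tensor_bounded (tensor_partialE i tE).1.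
apply: (@abel_integrable_bounded _ _ _ B) => //; exact: partial_comp_measurable.
Qed.

Lemma grad_lipschitz E : tensor E -> exists2 L, 0 <= L &
  forall i x y, `|partial i E x - partial i E y| <= L * `|x - y|.
Proof.
move=> tE; have [L0 L00 h0] := tensor_lipschitz (tensor_partialE 0 tE).1.
have [L1 L10 h1] := tensor_lipschitz (tensor_partialE 1 tE).1.
exists (L0 + L1) => [|i x y]; first exact: addr_ge0.
have [->|->] := ord2P i.
- by apply: le_trans (h0 x y) _; rewrite ler_wpM2r// lerDl.
- by apply: le_trans (h1 x y) _; rewrite ler_wpM2r// lerDr.
Qed.

Let half_integralB_le E L u v (a t m : R) : tensor E -> 0 <= L ->
  (forall i x y, `|partial i E x - partial i E y| <= L * `|x - y|) ->
  {within `[0, 1], continuous u} -> {within `[0, 1], continuous v} ->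
  0 <= a <= t -> t <= 1 -> 0 <= m ->
  (forall s, 0 <= s < a -> v s = u s) ->
  (forall s, a <= s <= t -> `|v s - u s| <= m) ->
  `|half_integral (grad E \o u) t - half_integral (grad E \o v) t| <=
    (Gamma (2^-1 : R))^-1 * (L * m * (2 * Num.sqrt (t - a))).
Proof.
move=> tE L0 hL cu cv at01 t1 m0 veq vm.
have G0 : 0 <= (Gamma (2^-1 : R))^-1 by rewrite Gamma_half invr_ge0 sqrtr_ge0.
apply: norm_rV_le => [|i].
  by rewrite !mulr_ge0// sqrtr_ge0.
have coordB (x y : 'rV[R]_2) : (x - y) 0 i = x 0 i - y 0 i by rewrite !mxE.
move: (half_integral_grad E u t i) (half_integral_grad E v t i).
move: (half_integral _ t) (half_integral _ t) => A B EA EB.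
rewrite coordB EA EB.
rewrite -mulrBr normrM (ger0_norm G0).
apply: (ler_wpM2l G0).
apply: abel_diff_le => //.
- exact: partial_comp_abel_integrable.
- exact: partial_comp_abel_integrable.
- by move=> s /veq ->.
- move=> s /vm h; apply: le_trans (hL _ _ _) _; rewrite ler_wpM2l//.
  by rewrite distrC.
Qed.

(** Two solutions that agree up to time a agree on [a, a + h] as soon as
    2 L sqrt h / Gamma(1/2) < 1, with h independent of a: the kernel contributes
    only its mass 2 sqrt h on the new piece. *)
Lemma mild_solution_unique E u v : tensor E ->
  mild_solution E u -> mild_solution E v ->
  forall t, 0 <= t <= 1 -> v t = u t.
Proof.
move=> tE [cu eu] [cv ev]; have [L L0 hL] := grad_lipschitz tE.
have G0 : 0 <= (Gamma (2^-1 : R))^-1 by rewrite Gamma_half invr_ge0 sqrtr_ge0.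
(* This makes 2 L sqrt h / Gamma(1/2) at most 1/2. *)
pose c := (Gamma (2^-1 : R))^-1 * L * 4 + 1.
have c0 : 0 < c by rewrite ltr_wpDl// !mulr_ge0.
pose h := (c^-1) ^+ 2.
have h0 : 0 < h by rewrite exprn_gt0// invr_gt0.
have sh : Num.sqrt h = c^-1 by rewrite sqrtr_sqr ger0_norm// invr_ge0 ltW.
suff step k t : 0 <= t <= 1 -> t <= k%:R * h -> v t = u t.
  move=> t t01; apply: (step (Num.truncn (t / h)).+1) => //.
  by rewrite -ler_pdivrMr// ltW// truncnS_gt.
elim: k t => [t /andP[t0 t1]|k IH t /andP[t0 t1] tk].
  rewrite mul0r => tn0; have -> : t = 0 by apply/eqP; rewrite eq_le t0 tn0.
  have z01 : (0 : R) <= (0 : R) <= (1 : R) by rewrite lexx ler01.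
  by rewrite (eu _ z01) (ev _ z01) (half_integral0 (grad E \o v)) (half_integral0 (grad E \o u)).
have [tk'|kt] := leP t (k%:R * h); first by apply: IH => //; rewrite t0.
pose a := k%:R * h; have a0 : 0 <= a by rewrite mulr_ge0// ltW.
have sub : `[a, t]%classic `<=` `[0, 1]%classic by apply: subset_itv; rewrite bnd_simp.
have [|s sat smax] := @EVT_max R (fun s => `|v s - u s|) a t (ltW kt).
  apply: continuous_subspaceW sub _.
  have cvu : {within `[0, 1], continuous (fun s => v s - u s)}.
    by move=> s; apply: continuousB; [exact: cv|exact: cu].
  move=> s; apply: (@continuous_comp _ _ _ ((fun s => v s - u s) : subspace `[0, 1] -> _)
    (@Num.norm _ 'rV[R]_2)); first exact: cvu.
  exact: norm_continuous.
set m := `|v s - u s| in smax.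
have {}smax r : a <= r <= t -> `|v r - u r| <= m.
  by move=> rat; apply: smax; rewrite in_itv.
move: sat; rewrite in_itv /= => /andP[as' st].
have s1 := le_trans st t1; have s0 := le_trans a0 as'.
have : m <= (Gamma (2^-1 : R))^-1 * (L * m * (2 * Num.sqrt (s - a))).
  have s01 : 0 <= s <= 1 by rewrite s0.
  have m0 : 0 <= m by exact: normr_ge0.
  have Em : m = `|half_integral (grad E \o u) s - half_integral (grad E \o v) s|.
    rewrite /m (ev _ s01) (eu _ s01).
    by move: (half_integral _ s) (half_integral _ s) => A B; rewrite opprK addrC.
  rewrite [leLHS]Em; apply: half_integralB_le => //.
  - by rewrite a0.
  - by move=> r /andP[r0 ra]; apply: IH; rewrite ?r0 ?(ltW ra)// (le_trans (ltW ra))// (le_trans as').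
  - by move=> r /andP[ar rs]; apply: smax; rewrite ar (le_trans rs).
have ssa : Num.sqrt (s - a) <= c^-1.
  rewrite -sh ler_sqrt ?(ltW h0)// lerBlDl (le_trans st)// (le_trans tk)//.
  by rewrite -natr1 mulrDl mul1r.
have m0 : 0 <= m by exact: normr_ge0.
move=> mle; have {mle} : m <= m / 2.
  apply: le_trans mle _.
  apply: (@le_trans _ _ ((Gamma 2^-1)^-1 * (L * m * (2 * c^-1)))).
    by rewrite ler_wpM2l// ler_wpM2l ?mulr_ge0// ler_wpM2l.
  have : (Gamma 2^-1)^-1 * L * 4 * c^-1 <= 1 by rewrite ler_pdivrMr// mul1r lerDl.
  move: (c^-1) (Gamma _)^-1 => x g gx.
  rewrite [leLHS](_ : _ = m / 2 * (g * L * 4 * x)); last by field.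
  by rewrite ler_piMr ?divr_ge0.
move=> mm; have {mm} m00 : m = 0 by lra.
have := smax t; rewrite (ltW kt) lexx => /(_ isT).
by rewrite m00 normr_le0 subr_eq0 => /eqP.
Qed.

End uniqueness.

Section classical.
Context {R : realType}.
Notation mu := (@lebesgue_measure R).
Implicit Types (E : 'rV[R]_2 -> R) (v : R -> 'rV[R]_2).

Lemma derive1_rV v (x : R) (a : 'rV[R]_2) :
  (forall i, has_deriv (fun s => v s 0 i) x (a 0 i)) ->
  derivable v x 1 /\ derive1 v x = a.
Proof.
move=> dv.
have H : h^-1 *: ((v \o shift x) (h *: 1) - v x) @[h --> 0^'] --> a.
  apply/cvgrPdist_le => e e0.
  have : \forall h \near 0^', forall i : 'I_2,
      `|a 0 i - (h^-1 *: ((v \o shift x) (h *: 1) - v x)) 0 i| <= e.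
    apply: filter_forall => i.
    have [/cvgrPdist_le/(_ _ e0) + D] := dv i.
    rewrite -[lim _]/('D_1 (fun s => v s 0 i) x) D; apply: filterS => h.
    by rewrite !mxE.
  by apply: filterS => h hi; apply: norm_rV_le (ltW e0) _ => i; have := hi i; rewrite !mxE.
split; first by apply/cvg_ex; exists a.
by rewrite derive1E; exact: cvg_lim H.
Qed.

Lemma abs_continuous_dom (V W : normedModType R) (v : R -> V) (w : R -> W) (a b C : R) :
  0 < C -> (forall x y, a <= x <= b -> a <= y <= b -> `|w x - w y| <= C * `|v x - v y|) ->
  abs_continuous a b v -> abs_continuous a b w.
Proof.
move=> C0 wv acv e e0; have [d d0 H] := acv _ (divr_gt0 e0 C0).
exists d => // n l r lr tr ld; have := H n l r lr tr ld.
rewrite ltr_pdivlMr// mulr_suml; apply: le_lt_trans; apply: ler_sum => i _.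
have [al lri rb] := lr i; rewrite mulrC; apply: wv.
  by rewrite rb (le_trans al).
by rewrite al (le_trans lri).
Qed.

(** Half-integrating the equation once more turns the Caputo derivative into
    the increment of v. *)
Lemma classical_mild E v : tensor E -> classical_solution E v -> mild_solution E v.
Proof.
move=> tE [acv v0 eqv]; have cv := abs_continuous_within acv.
split=> // t /andP[t0 t1]; have [<-|tn0] := eqVneq 0 t.
  by rewrite v0 (half_integral0 (grad E \o v)) oppr0.
have {tn0} tgt0 : 0 < t by rewrite lt0r eq_sym tn0.
have spi : 0 < Num.sqrt (@pi R) by rewrite sqrtr_gt0 pi_gt0.
have ftc i : exists g : R -> R, [/\ mu.-integrable setT (EFin \o g),
    forall t, 0 <= t <= 1 -> v t 0 i = \int[mu]_(x in `[0, t]) g x &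
    {ae mu, forall x, 0 < x < 1 -> has_deriv (fun s => v s 0 i) x (g x)}].
  have [|g [intg gE dg]] := @abs_continuous_ftc R (fun s => v s 0 i).
    apply: (abs_continuous_dom ltr01) acv => x y _ _.
    by rewrite mul1r; have := ler_coord_norm (v x - v y) i; rewrite !mxE.
  by exists g; split=> // s s01; rewrite -gE// v0 mxE subr0.
have /choice[g gP] := ftc.
have dv : {ae mu, forall s, 0 < s < 1 -> forall i, derive1 v s 0 i = g i s}.
  have [_ _ d0] := gP 0; have [_ _ d1] := gP 1.
  have d01 : {ae mu, forall s,
      (0 < s < 1 -> has_deriv (fun s => v s 0 0) s (g 0 s)) /\
      (0 < s < 1 -> has_deriv (fun s => v s 0 1) s (g 1 s))}.
    exact: (@filterI _ _ (ae_filter_ringOfSetsType mu)).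
  move: d01; apply: filterS; first exact: (ae_filter_ringOfSetsType mu).
  move=> s [h0 h1] s01 i.
  have [|_ ->] := @derive1_rV v s (\row_i g i s); last by rewrite mxE.
  move=> {}i; rewrite mxE; by have [->|->] := ord2P i; [exact: h0|exact: h1].
have gabel s i : 0 < s <= 1 -> abel_integrable (g i) s /\
    abel (g i) s = - (Gamma (2^-1 : R) * partial i E (v s)).
  move=> s01; have [defs eqs] := eqv _ s01; have [intg _ _] := gP i.
  have /andP[s0 s1] := s01.
  have mk : measurable_fun `[0, s] (fun r => (s - r) `^ (- 2^-1) * g i r).
    apply: measurable_funM; first exact: measurable_kernel.
    by apply: measurable_funTS; apply/measurable_EFinP; exact: measurable_int intg.
  have aek : {ae mu, forall r, `[0, s]%classic r ->
      half_kernel (derive1 v) s i r = (s - r) `^ (- 2^-1) * g i r}.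
    have neq (c : R) : {ae mu, forall r, r != c}.
      exists [set c]; split; [exact: measurable_set1|exact: lebesgue_measure_set1|].
      by move=> r /= /negP; rewrite negbK => /eqP.
    have neq01 : {ae mu, forall r : R, r != 0 /\ r != 1}.
      by apply: (@filterI _ _ (ae_filter_ringOfSetsType mu)); exact: neq.
    have : {ae mu, forall r, (0 < r < 1 -> forall i, derive1 v r 0 i = g i r) /\
        (r != 0 /\ r != 1)}.
      exact: (@filterI _ _ (ae_filter_ringOfSetsType mu)).
    apply: filterS; first exact: (ae_filter_ringOfSetsType mu).
    move=> r [dr [r0 r1]]; rewrite /= in_itv /= => /andP[r0' rs].
    rewrite /half_kernel dr// lt0r r0 r0' lt_neqAle r1.
    exact: le_trans s1.
  have [intk Ek] := ae_eq_integrable_Rintegral (measurable_itv _) mk aek (defs i).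
  split=> //; rewrite /abel -Ek.
  have := congr1 (fun x : 'rV[R]_2 => x 0 i) eqs.
  rewrite /caputo_half !mxE => Es.
  by rewrite -mulrN -Es mulrA divff ?mul1r// Gamma_half gt_eqF.
apply/rowP => i; have [intg gE _] := gP i.
have := @abel_abel R (g i) t tgt0 intg _.
rewrite -gE ?t0// => H.
have {H} : abel (abel (g i)) t = pi * v t 0 i.
  by apply: H => s /andP[s0 st]; apply: (gabel _ _ _).1; rewrite s0 (le_trans st).
have intE := partial_comp_abel_integrable i tE cv t1.
move=> H.
pose k s := (t - s) `^ (- 2^-1).
have eq12 s : 0 < s <= t ->
    k s * (- Gamma (2^-1 : R) * partial i E (v s)) = k s * abel (g i) s.
  by move=> /andP[s0 st]; rewrite (gabel _ _ _).2 ?mulNr// s0 (le_trans st).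
have int1 : mu.-integrable `[0, t]
    (EFin \o (fun s => k s * (- Gamma (2^-1 : R) * partial i E (v s)))).
  rewrite (_ : EFin \o _ = (fun s => (- Gamma (2^-1 : R))%:E *
    (EFin \o (fun s => (k s * partial i E (v s))%R)) s)%E).
    exact: integrableZl.
  by apply/funext => s /=; rewrite -EFinM; congr EFin; ring.
have [_ E12] := integrable_eq_oc eq12 int1.
have {E12 H} : - Gamma (2^-1 : R) * abel (fun s => partial i E (v s)) t = pi * v t 0 i.
  rewrite -H {2}/abel -/(k _) -E12 -RintegralZl//.
  by apply: eq_Rintegral => s _; rewrite /k; ring.
rewrite Gamma_half => H; have := half_integral_grad E v t i; rewrite Gamma_half.
move: (half_integral _ t) => A EA; rewrite [RHS]mxE EA.
apply: (mulfI (x := pi)); first by rewrite gt_eqF// pi_gt0.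
rewrite -H -[X in _ = X * _](sqr_sqrtr (pi_ge0 R)).
by field; rewrite gt_eqF.
Qed.

End classical.

(** * Rational bounds for pi *)
Section taylor.
Context {R : realType}.

(** 1/(2n)!, by a recursion which unfolds to small numerals. *)
Fixpoint cos_weight (n : nat) : R :=
  if n is m.+1 then cos_weight m / ((m.*2.+1)%:R * (m.*2.+2)%:R) else 1.

Definition cos_taylor (n : nat) (x : R) : R :=
  \sum_(k < n) (-1) ^+ k * (cos_weight k * x ^+ k.*2).

Definition sin_taylor (n : nat) (x : R) : R :=
  \sum_(k < n) (-1) ^+ k * (cos_weight k / (k.*2.+1)%:R * x ^+ k.*2.+1).

Lemma cos_taylorS n x : cos_taylor n.+1 x =
  cos_taylor n x + (-1) ^+ n * (cos_weight n * x ^+ n.*2).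
Proof. by rewrite /cos_taylor big_ord_recr. Qed.

Lemma sin_taylorS n x : sin_taylor n.+1 x =
  sin_taylor n x + (-1) ^+ n * (cos_weight n / (n.*2.+1)%:R * x ^+ n.*2.+1).
Proof. by rewrite /sin_taylor big_ord_recr. Qed.

Lemma has_deriv_sin_taylor n x : has_deriv (sin_taylor n) x (cos_taylor n x).
Proof.
elim: n => [|n IH].
  rewrite /cos_taylor big_ord0; apply: eq_has_deriv (has_deriv_cst 0 x) => y.
  by rewrite /sin_taylor big_ord0.
apply: (eq_has_deriv (fun y => esym (sin_taylorS n y))).
rewrite cos_taylorS; apply: has_derivD; first exact: IH.
apply: has_derivZ; apply: has_deriv_eq.
  by apply: has_derivZ; exact: has_derivX.
by rewrite /= mulrA divfK.
Qed.

Lemma has_deriv_cos_taylor n x :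
  has_deriv (cos_taylor n.+1) x (- sin_taylor n x).
Proof.
elim: n => [|n IH].
  rewrite /sin_taylor big_ord0 oppr0; apply: eq_has_deriv (has_deriv_cst 1 x) => y.
  by rewrite /cos_taylor big_ord1 !mul1r expr0.
apply: (eq_has_deriv (fun y => esym (cos_taylorS n.+1 y))).
rewrite sin_taylorS opprD; apply: has_derivD; first exact: IH.
apply: has_deriv_eq.
  by apply: has_derivZ; apply: has_derivZ; exact: has_derivX.
rewrite doubleS /= exprS; move: (cos_weight n) ((-1) ^+ n) (x ^+ n.*2.+1) => a b y.
have : n.*2.+1%:R != 0 :> R by []; have : n.*2.+2%:R != 0 :> R by [].
by move: (n.*2.+1%:R) (n.*2.+2%:R) => A B B0 A0; field; rewrite A0.
Qed.

Lemma cos_taylor0 n : cos_taylor n.+1 0 = 1.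
Proof.
rewrite /cos_taylor big_ord_recl /= !mul1r expr0 big1 ?addr0// => i _.
by rewrite doubleS expr0n /= !mulr0.
Qed.

Lemma sin_taylor_0 n : sin_taylor n 0 = 0.
Proof. by rewrite /sin_taylor big1// => i _; rewrite expr0n /= !mulr0. Qed.

Lemma ge0_deriv_ge0 (f f' : R -> R) (x : R) : 0 <= x -> f 0 = 0 ->
  (forall y, has_deriv f y (f' y)) -> (forall y, 0 <= y -> 0 <= f' y) -> 0 <= f x.
Proof.
move=> x0 f0 df f'0; rewrite -f0.
have [|z] := @MVT_segment R f f' 0 x x0 (fun z _ => (has_derivP _ _ _).1 (df z)).
  by apply: continuous_subspaceT; exact: has_deriv_continuousT df.
rewrite in_itv /= => /andP[z0 _]; rewrite subr0 => E.
by rewrite -subr_ge0 E mulr_ge0// f'0.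
Qed.

(** The truncated series alternately over- and underestimate: each comparison
    integrates to the next one, starting from cos <= 1. *)
Lemma cos_sin_taylor n : (forall x, 0 <= x -> 0 <= (-1) ^+ n.+1 * (cos x - cos_taylor n.+1 x)) /\
  (forall x, 0 <= x -> 0 <= (-1) ^+ n.+1 * (sin x - sin_taylor n.+1 x)).
Proof.
have dsin (x : R) : has_deriv sin x (cos x) by apply/has_derivP; exact: is_derive_sin.
have dcos (x : R) : has_deriv cos x (- sin x) by apply/has_derivP; exact: is_derive_cos.
have sin_step m : (forall x, 0 <= x -> 0 <= (-1) ^+ m * (cos x - cos_taylor m x)) ->
    forall x, 0 <= x -> 0 <= (-1) ^+ m * (sin x - sin_taylor m x).
  move=> H x x0; apply: (@ge0_deriv_ge0 (fun y => (-1) ^+ m * (sin y - sin_taylor m y))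
    (fun y => (-1) ^+ m * (cos y - cos_taylor m y))) => //.
    by rewrite sin0 sin_taylor_0 subr0 mulr0.
  move=> y; apply: has_derivZ; apply: has_derivB; first exact: dsin.
  exact: has_deriv_sin_taylor.
have cos_step m : (forall x, 0 <= x -> 0 <= (-1) ^+ m * (sin x - sin_taylor m x)) ->
    forall x, 0 <= x -> 0 <= (-1) ^+ m.+1 * (cos x - cos_taylor m.+1 x).
  move=> H x x0.
  apply: (@ge0_deriv_ge0 (fun y => (-1) ^+ m.+1 * (cos y - cos_taylor m.+1 y))
    (fun y => (-1) ^+ m * (sin y - sin_taylor m y))) => //.
    by rewrite cos0 cos_taylor0 subrr mulr0.
  move=> y; apply: has_deriv_eq.
    apply: has_derivZ; apply: has_derivB; first exact: dcos.
    exact: has_deriv_cos_taylor.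
  by rewrite exprS; ring.
elim: n => [|n [_ IH]].
  have H x : 0 <= x -> 0 <= (-1) ^+ 1 * (cos x - cos_taylor 1 x).
    move=> _; rewrite /cos_taylor big_ord1 !mul1r expr0 expr1 mulN1r opprB subr_ge0.
    exact: cos_le1.
  by split=> //; exact: sin_step.
have H := cos_step _ IH.
by split=> //; exact: sin_step.
Qed.

Lemma pihalf_lt (q : R) : 0 <= q <= 2 -> cos q < 0 -> pi / 2 < q.
Proof.
move=> /andP[q0 q2] cq; have [//|qp] := ltP (pi / 2) q.
have : 0 <= cos q by apply: cos_ge0_pihalf; have := pi_gt0 R => ?; apply/andP; split; lra.
by rewrite leNgt cq.
Qed.

Lemma pihalf_gt (q : R) : 0 <= q <= 2 -> 0 < cos q -> q < pi / 2.
Proof.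
move=> /andP[q0 q2] cq; rewrite ltNge; apply/negP => pq.
have : cos q <= cos (pi / 2).
  have [<-//|pqn] := eqVneq (pi / 2) q.
  rewrite ltW// ltr_cos ?in_itv//=; first by rewrite lt_neqAle pqn.
    by have := pi_gt0 R => ?; apply/andP; split; lra.
  by rewrite q0 (le_trans q2)// pi_ge2.
by rewrite cos_pihalf leNgt cq.
Qed.

(** The decimal n.abc, in blocks of 3, 3 and 2 digits after the point. *)
Definition dec8 (n a b c : nat) : R := n%:R + a%:R / 10 ^+ 3 + b%:R / 10 ^+ 6 + c%:R / 10 ^+ 8.

(** The first terms left out, of order 10^-10 and 10^-12, are below the distances
    of the two arguments to pi / 2, so the Taylor polynomials have the sign of
    the cosine. *)
Lemma cos_pi_bounds : 0 < cos (dec8 1 570 796 32) /\ cos (dec8 1 570 796 33) < 0.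
Proof.
have [/(_ (dec8 1 570 796 32)) lo _] := cos_sin_taylor 7.
have [/(_ (dec8 1 570 796 33)) hi _] := cos_sin_taylor 8.
split.
  have p0 : 0 <= dec8 1 570 796 32 by rewrite /dec8; lra.
  have := lo p0; move: (cos _) => c {lo hi p0}.
  rewrite !cos_taylorS /cos_taylor big_ord0 /=.
  rewrite !doubleS double0 /dec8.
  lra.
have p0 : 0 <= dec8 1 570 796 33 by rewrite /dec8; lra.
have := hi p0; move: (cos _) => c {lo hi p0}.
rewrite !cos_taylorS /cos_taylor big_ord0 /=.
rewrite !doubleS double0 /dec8.
lra.
Qed.

Lemma pihalf_bounds : dec8 1 570 796 32 < pi / 2 < dec8 1 570 796 33.
Proof.
have [lo hi] := cos_pi_bounds; apply/andP; split.
  by apply: pihalf_gt lo; rewrite /dec8; lra.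
by apply: pihalf_lt hi; rewrite /dec8; lra.
Qed.
End taylor.

(** * The rate of change of the energy *)
Section rate.
Context {R : realType}.
Implicit Types eps t : R.

(** Up to a positive factor, the derivative of the energy along the curve. *)
Definition bracket eps t : R := 9 / 2 * t * (1 - t) - (1 + eps ^+ 2).

Definition rate eps t : R := Gamma (3 / 2) / (2 * Num.sqrt t) * bracket eps t.

Lemma small_eps eps : 0 < eps -> (eps < 1 / (2 * Num.sqrt 2)) = (8 * eps ^+ 2 < 1).
Proof.
move=> e0; have s0 : 0 < 2 * Num.sqrt (2 : R) by rewrite mulr_gt0// sqrtr_gt0.
rewrite ltr_pdivlMr// -(@ltr_pXn2r _ 2)// ?nnegrE ?ler01// ?mulr_ge0//; try exact: ltW.
by rewrite expr1n !exprMn sqr_sqrtr//; congr (_ < _); ring.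
Qed.

(** Completing the square, the bracket is 9/8 (D - (2 t - 1)^2), where D is the
    number under the root in tminus and tplus. *)
Lemma bracket_gt0 eps t : 0 < bracket eps t <-> tminus eps < t < tplus eps.
Proof.
rewrite /bracket /tminus /tplus; set D := 1 - _ / 9.
have -> : 9 / 2 * t * (1 - t) - (1 + eps ^+ 2) = 9 / 8 * (D - (2 * t - 1) ^+ 2).
  by rewrite /D; field.
have r0 := sqrtr_ge0 D.
have : Num.sqrt D ^+ 2 = D \/ (D <= 0 /\ Num.sqrt D = 0).
  have [D0|D0] := leP 0 D; [left; exact: sqr_sqrtr|right].
  by rewrite ltW// ler0_sqrtr// ltW.
move: (Num.sqrt D) r0 => r r0 H; split=> [h|/andP[h1 h2]].
  case: H => [rD|[D0 r00]]; last by have := sqr_ge0 (2 * t - 1); lra.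
  by apply/andP; split; nra.
case: H => [rD|[D0 r00]]; last by lra.
nra.
Qed.

Lemma Gamma_three_halves_gt0 : 0 < Gamma (3 / 2 : R).
Proof. by rewrite Gamma_three_halves divr_gt0// sqrtr_gt0 pi_gt0. Qed.

Lemma rate_gt0 eps t : 0 < t -> 0 < rate eps t <-> tminus eps < t < tplus eps.
Proof.
move=> t0; rewrite -bracket_gt0 /rate pmulr_rgt0//.
by rewrite divr_gt0 ?Gamma_three_halves_gt0// mulr_gt0// sqrtr_gt0.
Qed.

(** The bracket is largest at t = 1/2, the midpoint of the window. *)
Lemma positive_rate_window eps : 0 < eps ->
  (exists t, tminus eps < t < tplus eps) <-> eps < 1 / (2 * Num.sqrt 2).
Proof.
move=> e0; rewrite small_eps//.
have -> : 8 * eps ^+ 2 < 1 <-> 0 < bracket eps 2^-1.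
  by rewrite /bracket; split=> h; lra.
split=> [[t /bracket_gt0]|/bracket_gt0]; last by exists 2^-1.
by rewrite /bracket; have := sqr_ge0 (t - 2^-1); lra.
Qed.

(** The equation for a critical point of rate. *)
Lemma tstar_quadratic eps : 1 + eps ^+ 2 = 27 / 2 * tstar eps ^+ 2 - 9 / 2 * tstar eps.
Proof.
rewrite /tstar; have : Num.sqrt (81 + 216 * (1 + eps ^+ 2)) ^+ 2 = 81 + 216 * (1 + eps ^+ 2).
  by rewrite sqr_sqrtr//; have := sqr_ge0 eps; lra.
by move: (Num.sqrt _) => r rE; lra.
Qed.

Lemma tstar_ge eps : 1 / 3 <= tstar eps.
Proof.
have : 9 <= Num.sqrt (81 + 216 * (1 + eps ^+ 2)).
  rewrite -[leLHS]ger0_norm// -sqrtr_sqr ler_sqrt; have := sqr_ge0 eps; lra.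
by rewrite /tstar; lra.
Qed.

Lemma tstar_le1 eps : eps ^+ 2 <= 8 -> tstar eps <= 1.
Proof.
move=> e8; have := tstar_quadratic eps; have := tstar_ge eps.
move: (tstar eps) => t t3 E; nra.
Qed.

(** With x = sqrt t and a = sqrt (tstar eps) the bracket over x falls short of
    its value at a by 9/2 (x - a)^2 (x^2 + 2 a x + 3 a^2 - 1) / x: the equation
    of tstar makes a a critical point, hence a double root of the difference.
    The last factor is positive since 3 a^2 >= 1. *)
Lemma rate_le_tstar eps t : 0 < t -> rate eps t <= rate eps (tstar eps).
Proof.
move=> t0; have s3 := tstar_ge eps; have k := tstar_quadratic eps.
have s0 : 0 < tstar eps by lra.
have x0 : 0 < Num.sqrt t by rewrite sqrtr_gt0.
have a0 : 0 < Num.sqrt (tstar eps) by rewrite sqrtr_gt0.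
have tE : t = Num.sqrt t ^+ 2 by rewrite sqr_sqrtr// ltW.
have sE : tstar eps = Num.sqrt (tstar eps) ^+ 2 by rewrite sqr_sqrtr// ltW.
rewrite /rate /bracket k -subr_ge0; have := Gamma_three_halves_gt0.
move: (Gamma _) => c c0; move: (Num.sqrt t) x0 tE => x x0 ->.
move: s3 sE {k s0}; move: (tstar eps) (Num.sqrt _) a0 => s a a0 s3 sE.
rewrite sE in s3 *.
have -> : c / (2 * a) * (9 / 2 * a ^+ 2 * (1 - a ^+ 2) -
      (27 / 2 * (a ^+ 2) ^+ 2 - 9 / 2 * a ^+ 2)) -
    c / (2 * x) * (9 / 2 * x ^+ 2 * (1 - x ^+ 2) -
      (27 / 2 * (a ^+ 2) ^+ 2 - 9 / 2 * a ^+ 2)) =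
    9 / 4 * c * (x - a) ^+ 2 * ((x ^+ 2 + 2 * a * x + (3 * a ^+ 2 - 1)) / x).
  by field; rewrite !gt_eqF.
apply: mulr_ge0; first by rewrite mulr_ge0 ?sqr_ge0// mulr_ge0//; lra.
by apply: divr_ge0; [have := mulr_gt0 a0 x0; have := sqr_ge0 x; lra|exact: ltW].
Qed.

Lemma discr_cvg : Num.sqrt (1 - 8 * (1 + eps ^+ 2) / 9) @[eps --> (0 : R)^'+] --> (1 / 3 : R).
Proof.
have -> : (1 / 3 : R) = Num.sqrt (1 - 8 * (1 + 0 ^+ 2) / 9).
  rewrite -[LHS]ger0_norm; last by lra.
  by rewrite -sqrtr_sqr; congr Num.sqrt; field.
apply: cvg_at_right_filter.
apply: (@cont_sqrt _ (fun x => 1 - 8 * (1 + x ^+ 2) / 9)).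
apply: contB; first exact: cst_continuous.
apply: contM; last exact: cst_continuous.
apply: contZ; apply: contD; first exact: cst_continuous.
exact: exprn_continuous.
Qed.

Lemma tminus_cvg : tminus eps @[eps --> (0 : R)^'+] --> (1 / 3 : R).
Proof.
have -> : (1 / 3 : R) = 2^-1 * (1 - 1 / 3) by field.
by apply: cvgM; [exact: cvg_cst|apply: cvgB; [exact: cvg_cst|exact: discr_cvg]].
Qed.

Lemma tplus_cvg : tplus eps @[eps --> (0 : R)^'+] --> (2 / 3 : R).
Proof.
have -> : (2 / 3 : R) = 2^-1 * (1 + 1 / 3) by field.
by apply: cvgM; [exact: cvg_cst|apply: cvgD; [exact: cvg_cst|exact: discr_cvg]].
Qed.
End rate.

(** * The decimal values *)
Section decimals.
Context {R : realType}.

Lemma sqrt_bounds (a b c : R) : 0 <= a -> 0 <= c -> a ^+ 2 < b < c ^+ 2 -> a < Num.sqrt b < c.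
Proof.
move=> a0 c0 /andP[ab bc]; have b0 : 0 < b by apply: le_lt_trans ab; exact: sqr_ge0.
have := sqr_sqrtr (ltW b0); have := sqrtr_ge0 b; move: (Num.sqrt b) => s s0 sb.
by apply/andP; split; nra.
Qed.

Lemma discr_bounds : dec8 0 319 722 10 <
  Num.sqrt (1 - 8 * (1 + (1 / 10 : R) ^+ 2) / 9) < dec8 0 319 722 11.
Proof. by apply: sqrt_bounds; rewrite /dec8; [lra|lra|apply/andP; split; lra]. Qed.

Lemma tstar_bounds : dec8 0 486 967 45 + 11 / 10 ^+ 10 < tstar (1 / 10 : R) <
  dec8 0 486 967 45 + 13 / 10 ^+ 10.
Proof.
have : dec8 17 296 242 36 < Num.sqrt (81 + 216 * (1 + (1 / 10 : R) ^+ 2)) < dec8 17 296 242 37.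
  by apply: sqrt_bounds; rewrite /dec8; [lra|lra|apply/andP; split; lra].
by rewrite /tstar /dec8; move: (Num.sqrt _) => s /andP[h1 h2]; apply/andP; split; lra.
Qed.

Lemma tminus_rounded : rounds_to8 (tminus (1 / 10 : R)) 340 138 95.
Proof.
have := discr_bounds; rewrite /rounds_to8 /tminus /dec8; move: (Num.sqrt _) => s /andP[h1 h2].
by rewrite ler_norml; apply/andP; split; lra.
Qed.

Lemma tplus_rounded : rounds_to8 (tplus (1 / 10 : R)) 659 861 05.
Proof.
have := discr_bounds; rewrite /rounds_to8 /tplus /dec8; move: (Num.sqrt _) => s /andP[h1 h2].
by rewrite ler_norml; apply/andP; split; lra.
Qed.

Lemma tstar_rounded : rounds_to8 (tstar (1 / 10 : R)) 486 967 45.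
Proof.
have := tstar_bounds; rewrite /rounds_to8 /dec8; move: (tstar _) => s /andP[h1 h2].
by rewrite ler_norml; apply/andP; split; lra.
Qed.

Lemma max_rate_rounded : rounds_to8 (rate (1 / 10 : R) (tstar (1 / 10))) 072 538 20.
Proof.
have /andP[s1 s2] := tstar_bounds; have k := tstar_quadratic (1 / 10 : R).
have /andP[y1 y2] : dec8 0 697 830 53 < Num.sqrt (tstar (1 / 10 : R)) < dec8 0 697 830 54.
  apply: sqrt_bounds; [rewrite /dec8; lra|rewrite /dec8; lra|].
  by move: s1 s2; rewrite /dec8; move: (tstar _) => t ? ?; apply/andP; split; lra.
have /andP[p1 p2] : dec8 1 772 453 84 < Num.sqrt (pi : R) < dec8 1 772 453 86.
  have /andP[p1 p2] := @pihalf_bounds R.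
  apply: sqrt_bounds; [rewrite /dec8; lra|rewrite /dec8; lra|].
  by move: p1 p2; rewrite /dec8; move: (pi) => p ? ?; apply/andP; split; lra.
have -> : rate (1 / 10 : R) (tstar (1 / 10)) = Num.sqrt pi *
    (3 * tstar (1 / 10) - 4 / 3 * (1 + (1 / 10) ^+ 2)) / (4 * Num.sqrt (tstar (1 / 10))).
  have y0 : Num.sqrt (tstar (1 / 10 : R)) != 0 by rewrite gt_eqF// (lt_trans _ y1)// /dec8; lra.
  rewrite /rate /bracket Gamma_three_halves.
  (* By tstar_quadratic the bracket is linear in tstar, and so insensitive to
     the error made on it. *)
  have -> : 9 / 2 * tstar (1 / 10) * (1 - tstar (1 / 10)) - (1 + (1 / 10) ^+ 2) =
    3 * tstar (1 / 10) - 4 / 3 * (1 + (1 / 10) ^+ 2) :> R by lra.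
  by move: y0; move: (Num.sqrt (tstar _)) (Num.sqrt pi) (3 * _ - _) => y q N y0; field.
move: s1 s2 y1 y2 p1 p2 {k}; rewrite /rounds_to8 ler_norml /dec8.
move: (tstar _) (Num.sqrt (tstar _)) (Num.sqrt pi) => t y q s1 s2 y1 y2 p1 p2.
have y0 : 0 < 4 * y by lra.
have N0 : 0 < 3 * t - 4 / 3 * (1 + (1 / 10) ^+ 2) by lra.
rewrite lerBrDr lerBlDr ler_pdivlMr// ler_pdivrMr//; apply/andP; split.
  apply: (@le_trans _ _ ((1%:R + 772%:R / 10 ^+ 3 + 453%:R / 10 ^+ 6 + 84%:R / 10 ^+ 8) *
      (3 * t - 4 / 3 * (1 + (1 / 10) ^+ 2)))); first by lra.
  by rewrite ler_wpM2r ?(ltW N0)// ltW.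
apply: (@le_trans _ _ ((1%:R + 772%:R / 10 ^+ 3 + 453%:R / 10 ^+ 6 + 86%:R / 10 ^+ 8) *
    (3 * t - 4 / 3 * (1 + (1 / 10) ^+ 2)))); last by lra.
by rewrite ler_wpM2r ?(ltW N0)// ltW.
Qed.
End decimals.

(** * The energy and its gradient along the curve *)
Section energy.
Context {R : realType}.
Variable eps : R.
Hypothesis eps_gt0 : 0 < eps.
Implicit Types (x : 'rV[R]_2) (s t : R).

Let c : R := Gamma (3 / 2).

(** The energy is axis(x) + slope(x) y near the curve. Its derivative in y is
    slope(x), which must be - c (1 - 3 t / 2) at x = eps sqrt t. Its derivative
    in x is axis'(x) + slope'(x) y, which must be - c eps when y is the second
    coordinate x / eps (1 - (x / eps)^2) of the curve; this determines axis
    up to a constant. *)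
Definition energy_axis (y : R) : R :=
  - c * eps * y - c / eps ^+ 3 * y ^+ 3 + 3 / 5 * c / eps ^+ 5 * y ^+ 5.

Definition energy_slope (y : R) : R := - c + 3 / 2 * c / eps ^+ 2 * y ^+ 2.

Definition energy : 'rV[R]_2 -> R := fun x =>
  energy_axis (x 0 0) * plateau (x 0 0) * plateau (x 0 1) +
  energy_slope (x 0 0) * plateau (x 0 0) * (x 0 1 * plateau (x 0 1)).

Lemma tensor_energy : tensor energy.
Proof.
have smoothZX (a : R) n : smooth1 (fun y => a * y ^+ n).
  by apply: smooth1M; [exact: smooth1_cst|exact: smooth1X].
have smooth_axis : smooth1 energy_axis.
  apply: smooth1D; last exact: smoothZX.
  rewrite (_ : (fun _ => _) = (fun y => - c * eps * y + - (c / eps ^+ 3) * y ^+ 3)).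
    apply: smooth1D; last exact: smoothZX.
    by apply: smooth1M; [exact: smooth1_cst|exact: smooth1_id].
  by apply/funext => y; congr (_ + _); rewrite mulNr.
have smooth_slope : smooth1 energy_slope.
  by apply: smooth1D; [exact: smooth1_cst|exact: smoothZX].
apply: tensorD.
  apply: (@tensorM _ (fun y => energy_axis y * plateau y)).
    exact: test1_plateauM.
  exact: test1_plateau.
apply: (@tensorM _ (fun y => energy_slope y * plateau y) (fun y => y * plateau y)).
  exact: test1_plateauM.
by apply: test1_plateauM; exact: smooth1_id.
Qed.

Lemma energyE x : x 0 0 ^+ 2 <= 2 -> x 0 1 ^+ 2 <= 2 ->
  energy x = energy_axis (x 0 0) + energy_slope (x 0 0) * x 0 1.
Proof. by move=> x0 x1; rewrite /energy !plateau1// !mulr1. Qed.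

Lemma grad_energy x : x 0 0 ^+ 2 < 2 -> x 0 1 ^+ 2 < 2 ->
  partial 0 energy x = - c * eps - 3 * c / eps ^+ 3 * x 0 0 ^+ 2 +
    3 * c / eps ^+ 5 * x 0 0 ^+ 4 + 3 * c / eps ^+ 2 * x 0 0 * x 0 1 /\
  partial 1 energy x = energy_slope (x 0 0).
Proof.
move=> x0 x1.
have dexp n (y : R) : has_deriv (fun h => (h + y) ^+ n) 0 (n%:R * y ^+ n.-1).
  apply: has_deriv_eq.
    apply: (@has_deriv_comp _ (fun z => z ^+ n) (fun h => h + y)).
      exact: has_derivX.
    by apply: has_derivD; [exact: has_deriv_id|exact: has_deriv_cst].
  by rewrite add0r addr0 mulr1.
have near2 (y : R) : y ^+ 2 < 2 -> \forall h \near (0 : R), (h + y) ^+ 2 < 2.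
  move=> y2; have /(_ [set z | z < 2]) := has_deriv_continuous (dexp 2%N y).
  by apply; apply: lt_nbhsl; rewrite add0r.
have dlin (y : R) : has_deriv (fun h => h + y) 0 1.
  by apply: has_deriv_eq (dexp 1 y) _; rewrite mulr1.
have coordE i h j : (h *: delta_mx 0 i + x) 0 j = h * (j == i)%:R + x 0 j.
  by rewrite !mxE eqxx.
split.
- have [_ <-] := (tensor_partialE 0 tensor_energy).2 x.
  suff [_ ->] : has_deriv (fun h => energy (h *: delta_mx 0 0 + x)) 0
    (- c * eps - 3 * c / eps ^+ 3 * x 0 0 ^+ 2 +
    3 * c / eps ^+ 5 * x 0 0 ^+ 4 + 3 * c / eps ^+ 2 * x 0 0 * x 0 1) by [].
  apply: (@near_eq_has_deriv _ (fun h => energy_axis (h + x 0 0) +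
      energy_slope (h + x 0 0) * x 0 1)).
    have H := near2 _ x0; near=> h.
    rewrite energyE !coordE /= ?mulr1 ?mulr0 ?add0r//; last exact: ltW.
    by apply: ltW; near: h; exact: H.
  rewrite /energy_axis /energy_slope; apply: has_deriv_eq.
    apply: has_derivD; first apply: has_derivD; first apply: has_derivB.
    - by apply: has_derivZ; exact: dlin.
    - by apply: has_derivZ; exact: dexp.
    - by apply: has_derivZ; exact: dexp.
    apply: has_derivM (has_deriv_cst _ _); apply: has_derivD (has_deriv_cst _ _) _.
    by apply: has_derivZ; exact: dexp.
  by rewrite /= add0r; move: (x 0 0) (x 0 1) => a b; field; rewrite gt_eqF.
- have [_ <-] := (tensor_partialE 1 tensor_energy).2 x.
  suff [_ ->] : has_deriv (fun h => energy (h *: delta_mx 0 1 + x)) 0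
    (energy_slope (x 0 0)) by [].
  apply: (@near_eq_has_deriv _ (fun h => energy_axis (x 0 0) +
      energy_slope (x 0 0) * (h + x 0 1))).
    have H := near2 _ x1; near=> h.
    rewrite energyE !coordE /= ?mulr1 ?mulr0 ?add0r//; first exact: ltW.
    by apply: ltW; near: h; exact: H.
  apply: has_deriv_eq.
    by apply: has_derivD (has_deriv_cst _ _) _; apply: has_derivZ; exact: dlin.
  by rewrite add0r mulr1.
Unshelve. all: by end_near.
Qed.

Lemma curve0E s : curve eps s 0 0 = eps * Num.sqrt s.
Proof. by rewrite mxE. Qed.

Lemma curve1E s : curve eps s 0 1 = Num.sqrt s * (1 - s).
Proof. by rewrite mxE. Qed.

Hypothesis eps_le1 : eps <= 1.

Lemma curve_in_plateau s : 0 <= s <= 5 / 4 ->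
  curve eps s 0 0 ^+ 2 < 2 /\ curve eps s 0 1 ^+ 2 < 2.
Proof.
move=> /andP[s0 s1]; rewrite curve0E curve1E !exprMn sqr_sqrtr//; split; last by nra.
by apply: (@le_lt_trans _ _ s); [rewrite ler_piMl// expr_le1// ltW|lra].
Qed.

Lemma partial_energy_curve s : 0 <= s <= 5 / 4 ->
  partial 0 energy (curve eps s) = - (c * eps) /\
  partial 1 energy (curve eps s) = - (c * (1 - 3 / 2 * s)).
Proof.
move=> s01; have [h0 h1] := curve_in_plateau s01.
have [-> ->] := grad_energy h0 h1; rewrite /energy_slope curve0E curve1E.
have : Num.sqrt s ^+ 2 = s by case/andP: s01 => s0 _; exact: sqr_sqrtr.
by move: (Num.sqrt s) => x <-; split; field; rewrite gt_eqF.
Qed.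

Lemma energy_curve s : 0 <= s <= 5 / 4 ->
  energy (curve eps s) =
    c * Num.sqrt s * (- (1 + eps ^+ 2) + 3 / 2 * s - 9 / 10 * s ^+ 2).
Proof.
move=> s01; have [h0 h1] := curve_in_plateau s01.
rewrite energyE 1?ltW// /energy_axis /energy_slope curve0E curve1E.
have : Num.sqrt s ^+ 2 = s by case/andP: s01 => s0 _; exact: sqr_sqrtr.
by move: (Num.sqrt s) => x <-; field; rewrite gt_eqF.
Qed.

Lemma has_deriv_energy_curve t : 0 < t <= 1 ->
  has_deriv (energy \o curve eps) t (rate eps t).
Proof.
move=> /andP[t0 t1].
apply: (@near_eq_has_deriv _ (fun s =>
    c * Num.sqrt s * (- (1 + eps ^+ 2) + 3 / 2 * s - 9 / 10 * s ^+ 2))).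
  near=> s; rewrite /= energy_curve//; apply/andP; split; apply: ltW.
    by near: s; exact: lt_nbhsr.
  by near: s; apply: lt_nbhsl; lra.
apply: has_deriv_eq.
  apply: has_derivM.
    by apply: has_derivZ; apply: (has_deriv_sqrt t0); exact: has_deriv_id.
  apply: has_derivB; last by apply: has_derivZ; exact: has_derivX.
  apply: has_derivD (has_deriv_cst _ _) _.
  by apply: has_derivZ; exact: has_deriv_id.
rewrite /= /rate /bracket.
have : Num.sqrt t ^+ 2 = t by exact: sqr_sqrtr (ltW t0).
have : 0 < Num.sqrt t by rewrite sqrtr_gt0.
rewrite -/c.
by move: (Num.sqrt t) => x x0 <-; field; rewrite gt_eqF.
Unshelve. all: by end_near.
Qed.

End energy.

(** * Absolute continuity of the square root *)
Section sqrt_ac.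
Context {R : realType}.
Notation mu := (@lebesgue_measure R).

Lemma sum_disjoint_itv_le n (a b : 'I_n -> R) (m : R) : 0 <= m ->
  (forall i, [/\ 0 <= a i, a i <= b i & b i <= m]) ->
  trivIset setT (fun i => `]a i, b i[%classic) ->
  \sum_i (b i - a i) <= m.
Proof.
move=> m0 abm tr.
have mU : measurable (\big[setU/set0]_(i < n) `]a i, b i[%classic).
  by apply: bigsetU_measurable => i _; exact: measurable_itv.
have : (mu (\big[setU/set0]_(i < n) `]a i, b i[%classic) <= mu `[0%R, m]%classic)%E.
  apply: le_measure; rewrite ?inE//.
  apply: (big_ind (fun A => A `<=` `[0, m]%classic)) => [|A B sA sB|i _] //.
    by rewrite subUset.
  move=> x /=; rewrite !in_itv /= => /andP[ax xb].
  by have [a0 _ bm] := abm i; apply/andP; split; lra.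
rewrite measure_bigsetU_ord//.
rewrite lebesgue_measure_itv /= lte_fin sube0.
have -> : (if (0 < m)%R then m%:E else 0)%E = m%:E.
  by case: ltgtP m0 => // <-.
rewrite (eq_bigr (fun i => (b i - a i)%:E)) ?sumEFin ?lee_fin// => i _.
rewrite lebesgue_measure_itv /= lte_fin; have [_ ab _] := abm i.
by case: ltgtP ab => // ->; rewrite subrr.
Qed.

(** Near 0, where the slope blows up, the increments are bounded by the measure
    of the disjoint images; beyond y^2 the slope is at most 1/(2y). *)
Lemma abs_continuous_sqrt : abs_continuous 0 1 (@Num.sqrt R).
Proof.
move=> e e0; pose y := e / 2; have y0 : 0 < y by rewrite divr_gt0.
(* Lengths enter below divided by 2 y, and must contribute less than e / 2. *)
exists (y * e) => [|n l r lr tr ld]; first exact: mulr_gt0.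
pose h x := Num.min (Num.sqrt x) y.
have split_le i : `|Num.sqrt (r i) - Num.sqrt (l i)| <=
    (h (r i) - h (l i)) + (2 * y)^-1 * (r i - l i).
  have [l0 lri _] := lr i; have r0 := le_trans l0 lri.
  have := sqr_sqrtr l0; have := sqr_sqrtr r0.
  have : Num.sqrt (l i) <= Num.sqrt (r i) by rewrite ler_sqrt.
  rewrite /h => H; rewrite ger0_norm ?subr_ge0//; move: H.
  have := sqrtr_ge0 (l i); move: (Num.sqrt (l i)) (Num.sqrt (r i)) => x z x0 xz <- <-.
  rewrite -(@ler_pM2r _ (2 * y)); last by rewrite mulr_gt0.
  rewrite [leRHS]mulrDl [_^-1 * _ * _]mulrAC mulVf ?mul1r; last by rewrite gt_eqF// mulr_gt0.
  have [zy|yz] := leP z y; first by rewrite !min_l ?(le_trans xz)//; nra.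
  by have [xy|yx] := leP x y; nra.
apply: (le_lt_trans (ler_sum _ (fun i _ => split_le i))).
rewrite big_split /= -mulr_sumr.
suff : \sum_i (h (r i) - h (l i)) <= y.
  have : (2 * y)^-1 * \sum_i (r i - l i) < y.
    rewrite mulrC ltr_pdivrMr ?mulr_gt0//; apply: lt_le_trans ld _.
    by rewrite /y; lra.
  by move=> h1 h2; rewrite [ltRHS]splitr; exact: ler_ltD.
apply: sum_disjoint_itv_le; first exact: ltW.
  move=> i; have [l0 lri _] := lr i; rewrite /h; split.
  - by rewrite le_min sqrtr_ge0 ltW.
  - by rewrite le_min !ge_min lexx orbT ler_sqrt ?(le_trans l0)// lri.
  - by rewrite ge_min lexx orbT.
move=> i j _ _ [z [/=]]; rewrite !in_itv /= => zi zj; apply: tr => //.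
have sub k : h (l k) < z < h (r k) -> l k < z ^+ 2 < r k.
  have [l0 lrk _] := lr k; rewrite /h => /andP[]; rewrite lt_min gt_min.
  move=> /orP[lz|yz] /andP[zr zy]; last by have := lt_trans yz zy; rewrite ltxx.
  have := sqr_sqrtr l0; have := sqr_sqrtr (le_trans l0 lrk).
  have := sqrtr_ge0 (l k); move: lz zr; move: (Num.sqrt (l k)) (Num.sqrt (r k)) => a b.
  by move=> az zb a0 <- <-; apply/andP; split; nra.
by exists (z ^+ 2); split; rewrite /= in_itv /=; exact: sub.
Qed.

Lemma abs_continuous_curve (eps : R) : 0 <= eps <= 1 -> abs_continuous 0 1 (curve eps).
Proof.
move=> /andP[e0 e1]; apply: (@abs_continuous_dom _ _ _ (@Num.sqrt R) _ 0 1 4) => //; last first.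
  exact: abs_continuous_sqrt.
move=> x y /andP[x0 x1] /andP[y0 y1].
apply: norm_rV_le => [|i]; first by rewrite mulr_ge0.
have xx := sqr_sqrtr x0; have yy := sqr_sqrtr y0.
have a0 := sqrtr_ge0 x; have b0 := sqrtr_ge0 y.
have ab : Num.sqrt x <= 1 /\ Num.sqrt y <= 1 by split; nra.
have -> : (curve eps x - curve eps y) 0 i = (Num.sqrt x - Num.sqrt y) *
    (if i == 0 then eps else 1 - (Num.sqrt x ^+ 2 + Num.sqrt x * Num.sqrt y + Num.sqrt y ^+ 2)).
  by rewrite !mxE; case: ifP => _; [|rewrite -[in 1 - x]xx -[in 1 - y]yy]; ring.
rewrite normrM mulrC ler_wpM2r// ler_norml; case: ifP => _; apply/andP; split; nra.
Qed.

End sqrt_ac.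

(** * The curve solves the equation *)
Section curve.
Context {R : realType}.
Variable eps : R.
Hypothesis eps_gt0 : 0 < eps.
Hypothesis eps_le1 : eps <= 1.
Implicit Types (s t : R).
Notation mu := (@lebesgue_measure R).
Notation c := (Gamma (3 / 2 : R)).
Notation E := (energy eps).

Lemma curve0 : curve eps 0 = 0.
Proof. by apply/rowP => i; rewrite !mxE sqrtr0 mulr0 mul0r; case: ifP. Qed.

Lemma half_integral_grad_curve t : 0 <= t <= 1 ->
  curve eps t = - half_integral (grad E \o curve eps) t.
Proof.
move=> /andP[t0 t1]; have [->|tn0] := eqVneq t 0.
  by rewrite curve0 (half_integral0 (grad E \o curve eps)) oppr0.
have {tn0}t0 : 0 < t by rewrite lt0r tn0.
have [ic Ec] := Rintegral_abel_cst t0; have [ii Ei] := Rintegral_abel_id t0.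
have spi : 0 < Num.sqrt (pi : R) by rewrite sqrtr_gt0 pi_gt0.
have h s : s \in `[0, t] -> 0 <= s <= 5 / 4 /\ 0 <= t - s.
  by rewrite in_itv /= => /andP[s0 s1]; rewrite subr_ge0; split=> //; apply/andP; split; lra.
apply: rV2_eq; rewrite [RHS]mxE half_integral_grad /abel.
- have -> : \int[mu]_(s in `[0, t]) ((t - s) `^ (- 2^-1) * partial 0 E (curve eps s)) =
      \int[mu]_(s in `[0, t]) (- (c * eps) * (Num.sqrt (t - s))^-1).
    apply: eq_Rintegral => s; rewrite inE /= => /h[s01 st].
    by rewrite (partial_energy_curve eps_gt0 eps_le1 s01).1 powR_Nhalf// mulrC.
  rewrite RintegralZl// Ec curve0E subr0 Gamma_half Gamma_three_halves.
  by move: (Num.sqrt pi) spi (Num.sqrt t) => p p0 x; field; rewrite gt_eqF.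
- have -> : \int[mu]_(s in `[0, t]) ((t - s) `^ (- 2^-1) * partial 1 E (curve eps s)) =
      \int[mu]_(s in `[0, t]) (- c * (Num.sqrt (t - s))^-1 +
        3 / 2 * c * ((Num.sqrt (t - s))^-1 * s)).
    apply: eq_Rintegral => s; rewrite inE /= => /h[s01 st].
    rewrite (partial_energy_curve eps_gt0 eps_le1 s01).2 powR_Nhalf//.
    by move: (_^-1) c => x y; field.
  rewrite RintegralD//; last first.
  - exact: (@integrableZl _ _ _ mu _ _ (3 / 2 * c) _ ii).
  - exact: (@integrableZl _ _ _ mu _ _ (- c) _ ic).
  rewrite !RintegralZl// Ec Ei curve1E subr0 Gamma_half Gamma_three_halves.
  by move: (Num.sqrt pi) spi (Num.sqrt t) => p p0 x; field; rewrite gt_eqF.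
Qed.

Definition curve_velocity s : 'rV[R]_2 :=
  \row_i (if i == 0 then eps / 2 * (Num.sqrt s)^-1
          else 1 / 2 * (Num.sqrt s)^-1 - 3 / 2 * Num.sqrt s).

Lemma derive1_curve s : 0 < s -> derive1 (curve eps) s = curve_velocity s.
Proof.
move=> s0; apply: (derive1_rV _).2 => i.
have ds := has_deriv_sqrt s0 (has_deriv_id s).
have x0 : Num.sqrt s != 0 by rewrite gt_eqF// sqrtr_gt0.
have x2 := sqr_sqrtr (ltW s0).
have [->|->] := ord2P i.
- apply: (@eq_has_deriv _ (fun s => eps * Num.sqrt s)) => [y|]; first by rewrite curve0E.
  apply: has_deriv_eq; first by apply: has_derivZ; exact: ds.
  by rewrite mxE /=; move: (Num.sqrt s) x0 => x x0; field.
- apply: (@eq_has_deriv _ (fun s => Num.sqrt s * (1 - s))) => [y|]; first by rewrite curve1E.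
  apply: has_deriv_eq; first by apply: has_derivM; [exact: ds|exact: has_deriv_csub].
  by rewrite mxE /= -[in 1 - s]x2; move: (Num.sqrt s) x0 => x x0; field.
Qed.

Lemma caputo_half_curve t : 0 < t -> caputo_half_defined (curve eps) t /\
  caputo_half (curve eps) t 0 0 = c * eps /\
  caputo_half (curve eps) t 0 1 = c * (1 - 3 / 2 * t).
Proof.
move=> t0; have [ib Eb] := Rintegral_abel_beta t0; have [is_ Es] := Rintegral_abel_sqrt t0.
have spi : 0 < Num.sqrt (pi : R) by rewrite sqrtr_gt0 pi_gt0.
have pp : Num.sqrt (pi : R) ^+ 2 = pi by rewrite sqr_sqrtr// ltW// pi_gt0.
have H i : mu.-integrable `[0, t] (EFin \o half_kernel (derive1 (curve eps)) t i) /\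
    \int[mu]_(s in `[0, t]) half_kernel (derive1 (curve eps)) t i s =
    if i == 0 then eps / 2 * pi else 1 / 2 * pi - 3 / 2 * (t * pi / 2).
  have [->|->] := ord2P i.
  - pose f s := eps / 2 * ((Num.sqrt (t - s))^-1 * (Num.sqrt (s - 0))^-1).
    have fi : mu.-integrable `[0, t] (EFin \o f).
      exact: (@integrableZl _ _ _ mu _ _ (eps / 2) _ ib).
    have [|-> <-] := integrable_eq_oc _ fi (g := half_kernel (derive1 (curve eps)) t 0).
      move=> s /andP[s0 st]; rewrite /half_kernel derive1_curve// mxE powR_Nhalf ?subr_ge0//.
      by rewrite /f subr0 /= mulrCA.
    by split=> //; rewrite RintegralZl// Eb.
  - pose f s := 1 / 2 * ((Num.sqrt (t - s))^-1 * (Num.sqrt (s - 0))^-1) -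
      3 / 2 * ((Num.sqrt (t - s))^-1 * Num.sqrt s).
    have i1 : mu.-integrable `[0, t]
        (EFin \o fun s => 1 / 2 * ((Num.sqrt (t - s))^-1 * (Num.sqrt (s - 0))^-1)).
      exact: (@integrableZl _ _ _ mu _ _ (1 / 2) _ ib).
    have i2 : mu.-integrable `[0, t]
        (EFin \o fun s => 3 / 2 * ((Num.sqrt (t - s))^-1 * Num.sqrt s)).
      exact: (@integrableZl _ _ _ mu _ _ (3 / 2) _ is_).
    have fi : mu.-integrable `[0, t] (EFin \o f).
      exact: (@integrableB _ _ _ mu _ _ _ _ i1 i2).
    have [|-> <-] := integrable_eq_oc _ fi (g := half_kernel (derive1 (curve eps)) t 1).
      move=> s /andP[s0 st]; rewrite /half_kernel derive1_curve// mxE powR_Nhalf ?subr_ge0//.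
      by rewrite /f subr0 /= mulrBr; congr (_ - _); rewrite mulrCA.
    by split=> //; rewrite RintegralB// !RintegralZl// Eb Es.
split=> [i|]; first exact: (H i).1.
rewrite /caputo_half /half_integral !mxE !(H _).2 /= Gamma_half Gamma_three_halves.
move: pp; move: (Num.sqrt pi) spi => p p0 <-.
by split; field; rewrite gt_eqF.
Qed.

End curve.

Section curve_solution.
Context {R : realType}.
Variable eps : R.
Hypothesis eps_gt0 : 0 < eps.
Hypothesis eps_le1 : eps <= 1.
Notation c := (Gamma (3 / 2 : R)).
Notation E := (energy eps).

Let curve_ac : abs_continuous 0 1 (curve eps).
Proof. by apply: abs_continuous_curve; rewrite ltW. Qed.

Lemma curve_mild_unique : unique_on01 (mild_solution E) (curve eps).
Proof.
have mc : mild_solution E (curve eps).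
  by split; [exact: abs_continuous_within|move=> t; exact: half_integral_grad_curve].
by split=> // v mv t; exact: mild_solution_unique (tensor_energy _) mc mv t.
Qed.

Lemma curve_classical_unique : unique_on01 (classical_solution E) (curve eps).
Proof.
split=> [|v cv]; last first.
  exact: curve_mild_unique.2 (classical_mild (tensor_energy _) cv).
split; [exact: curve_ac|exact: curve0|] => t /andP[t0 t1].
have [dc [c0 c1]] := caputo_half_curve eps t0; split=> //.
have [|g0 g1] := @partial_energy_curve _ _ eps_gt0 eps_le1 t.
  by apply/andP; split; lra.
apply: rV2_eq; rewrite [RHS]mxE [X in _ = - X]mxE.
  by rewrite c0 g0 opprK.
by rewrite c1 g1 opprK.
Qed.

Lemma rate_dissipation t : 0 < t ->
  rate eps t = - dot (caputo_half (curve eps) t) (derive1 (curve eps) t).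
Proof.
move=> t0; have [_ [c0 c1]] := caputo_half_curve eps t0.
rewrite /dot derive1_curve//; move: (caputo_half _ t) c0 c1 => w c0 c1.
rewrite mxE sum_ord2 c0 c1 !mxE /= /rate /bracket.
have x0 : 0 < Num.sqrt t by rewrite sqrtr_gt0.
move: (sqr_sqrtr (ltW t0)); move: (Num.sqrt t) x0 c => x x0 g <-.
by field; rewrite gt_eqF.
Qed.

End curve_solution.

Theorem proposition4p1 (R : realType) :
  [/\ forall eps M : R,
        0 < eps -> eps < 1 / (2 * Num.sqrt 2) -> 0 < M ->
        exists (E : 'rV[R]_2 -> R) (Lambda : R),
          [/\ smooth E /\ compactly_supported E,
              forall x : 'rV[R]_2, loewner_le (- Lambda)%:M (Hess E x),
              unique_on01 (mild_solution E) (curve eps),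
              unique_on01 (classical_solution E) (curve eps) &
              [/\ forall t : R, 0 < t <= 1 ->
                    [/\ derivable (E \o curve eps) t 1,
                        derive1 (E \o curve eps) t =
                          - dot (caputo_half (curve eps) t) (derive1 (curve eps) t) &
                        derive1 (E \o curve eps) t =
                          Gamma (3 / 2) / (2 * Num.sqrt t) *
                            (9 / 2 * t * (1 - t) - (1 + eps ^+ 2))],
                  forall t : R, 0 < t <= 1 ->
                    (0 < derive1 (E \o curve eps) t <->
                     tminus eps < t < tplus eps),
                  0 < tstar eps <= 1 /\
                  (forall t : R, 0 < t <= 1 ->
                     derive1 (E \o curve eps) t <= derive1 (E \o curve eps) (tstar eps)) &
                  eps = 1 / 10 ->
                    rounds_to8 (derive1 (E \o curve eps) (tstar eps)) 072 538 20]],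
      forall eps : R, 0 < eps ->
        ((exists t : R, tminus eps < t < tplus eps) <->
         eps < 1 / (2 * Num.sqrt 2)),
      [/\ rounds_to8 (tminus (1 / 10 : R)) 340 138 95,
          rounds_to8 (tplus (1 / 10 : R)) 659 861 05 &
          rounds_to8 (tstar (1 / 10 : R)) 486 967 45],
      tminus eps @[eps --> (0 : R)^'+] --> (1 / 3 : R) &
      tplus eps @[eps --> (0 : R)^'+] --> (2 / 3 : R)].
Proof.
split.
- move=> eps M e0 e1 _.
  have e2 : 8 * eps ^+ 2 < 1 by rewrite -small_eps.
  have ele1 : eps <= 1 by nra.
  have rE t : 0 < t <= 1 -> derive1 (energy eps \o curve eps) t = rate eps t.
    by move=> t01; exact/has_deriv_derive1/has_deriv_energy_curve.
  have s01 : 0 < tstar eps <= 1.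
    have := tstar_ge eps; rewrite tstar_le1 ?andbT; last by lra.
    by lra.
  have [L hL] := tensor_Hess_bounded_below (tensor_energy eps).
  exists (energy eps), L; split.
  + have tE := tensor_energy eps.
    by split; [exact: tensor_smooth|exact: tensor_compactly_supported].
  + exact: hL.
  + exact: curve_mild_unique.
  + exact: curve_classical_unique.
  + split.
    * move=> t t01; have rt := rE t t01; have /andP[t0 _] := t01; split.
      - exact: (has_deriv_energy_curve e0 ele1 t01).1.
      - by rewrite rt; exact: rate_dissipation.
      - exact: rt.
    * by move=> t t01; rewrite (rE t t01); apply: rate_gt0; case/andP: t01.
    * split; first exact: s01.
      move=> t t01; rewrite (rE t t01) (rE _ s01).
      by apply: rate_le_tstar; case/andP: t01.
    * by move=> ee; rewrite (rE _ s01) ee; exact: max_rate_rounded.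
- exact: positive_rate_window.
- by split; [exact: tminus_rounded|exact: tplus_rounded|exact: tstar_rounded].
- exact: tminus_cvg.
- exact: tplus_cvg.
Qed.
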